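(* Let $\mathfrak R$ and $\mathfrak S$ be complete, separated two-sided linear topological rings with countable bases of neighborhoods of zero, and let $\mathfrak f\colon\mathfrak R\to\mathfrak S$ be a strongly right taut continuous ring map. Assume that the forgetful functor $\mathfrak R\text{-}\mathsf{Contra}\to\mathfrak R\text{-}\mathsf{Mod}$ is fully faithful. Then the commutative square diagram of forgetful functors $$\begin{array}{ccc}\mathfrak S\text{-}\mathsf{Separ}&\longrightarrow&\mathfrak S\text{-}\mathsf{Mod}\\ {\scriptstyle\mathfrak f_\sharp}\downarrow&&\downarrow{\scriptstyle\mathfrak f_*}\\ \mathfrak R\text{-}\mathsf{Separ}&\longrightarrow&\mathfrak R\text{-}\mathsf{Mod}\end{array}$$ is a pseudopullback diagram, and both its horizontal functors are fully faithful. Moreover, the forgetful functor $\mathfrak S\text{-}\mathsf{Contra}\to\mathfrak S\text{-}\mathsf{Mod}$ is fully faithful, too.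
   Context: All rings are associative and unital, and ring maps are unital ring homomorphisms. A topological ring is two-sided linear if open two-sided ideals form a base of neighborhoods of zero; it is complete and separated if the natural map to the projective limit of its quotients by all open subgroups is bijective. A ring map $\mathfrak f\colon\mathfrak R\to\mathfrak S$ of two-sided linear topological rings is strongly right taut if those open two-sided ideals $\mathfrak I\subset\mathfrak R$ for which the closure in $\mathfrak S$ of the right ideal $\mathfrak f(\mathfrak I)\mathfrak S$ generated by $\mathfrak f(\mathfrak I)$ is an open two-sided ideal of $\mathfrak S$ form a base of neighborhoods of zero in $\mathfrak R$. Contramodules. For a set $X$, let $\mathfrak R[[X]]$ be the set of all infinite formal linear combinations $\sum_{x\in X}r_xx$ whose coefficient families $(r_x\in\mathfrak R)_{x\in X}$ converge to zero (for every open subgroup $\mathfrak U\subset\mathfrak R$, $r_x\in\mathfrak U$ for all but finitely many $x$). A map $g\colon X\to Y$ induces $\mathfrak R[[g]]\colon\sum_x r_xx\mapsto\sum_y\bigl(\sum_{g(x)=y}r_x\bigr)y$, where infinite sums in $\mathfrak R$ are limits of finite partial sums. The functor $\mathfrak R[[-]]$ is a monad on sets with unit $\epsilon_X\colon x\mapsto 1\cdot x$ and multiplication $\phi_X\colon\mathfrak R[[\mathfrak R[[X]]]]\to\mathfrak R[[X]]$ given by opening parentheses. A left $\mathfrak R$-contramodule is a module (algebra) over this monad, i.e. a set $\mathfrak P$ with a map $\pi_{\mathfrak P}\colon\mathfrak R[[\mathfrak P]]\to\mathfrak P$ satisfying $\pi_{\mathfrak P}\epsilon_{\mathfrak P}=\mathrm{id}$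 and $\pi_{\mathfrak P}\circ\mathfrak R[[\pi_{\mathfrak P}]]=\pi_{\mathfrak P}\circ\phi_{\mathfrak P}$. These form an abelian category $\mathfrak R\text{-}\mathsf{Contra}$. Restricting $\pi_{\mathfrak P}$ to finite linear combinations gives the forgetful functor $\mathfrak R\text{-}\mathsf{Contra}\to\mathfrak R\text{-}\mathsf{Mod}$ to left $\mathfrak R$-modules. For an open right ideal $\mathfrak I\subset\mathfrak R$, $\mathfrak I\rightthreetimes\mathfrak P\subset\mathfrak P$ is the image under $\pi_{\mathfrak P}$ of the set of those elements of $\mathfrak R[[\mathfrak P]]$ whose coefficients all lie in $\mathfrak I$. The contramodule $\mathfrak P$ is separated if $\bigcap_{\mathfrak I}(\mathfrak I\rightthreetimes\mathfrak P)=0$ (over all open right ideals). $\mathfrak R\text{-}\mathsf{Separ}\subset\mathfrak R\text{-}\mathsf{Contra}$ is the full subcategory of separated left contramodules. Functors. A continuous $\mathfrak f$ induces maps $\mathfrak R[[X]]\to\mathfrak S[[X]]$; precomposing $\pi_{\mathfrak Q}\colon\mathfrak S[[\mathfrak Q]]\to\mathfrak Q$ with $\mathfrak R[[\mathfrak Q]]\to\mathfrak S[[\mathfrak Q]]$ defines the restriction of scalars $\mathfrak f_\sharp\colon\mathfrak S\text{-}\mathsf{Contra}\to\mathfrak R\text{-}\mathsf{Contra}$, which takes separated contramodules to separated ones. $\mathfrak f_*$ is the usual restriction of scalars on left modules. Given functors $F\colon\mathsf A\to\mathsf C$ and $G\colon\mathsf B\to\mathsf C$, their pseudopullback $\mathsf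 P$ is the category of triples $(A,B,\phi)$ with $A\in\mathsf A$, $B\in\mathsf B$ and $\phi\colon F(A)\simeq G(B)$ an isomorphism in $\mathsf C$ (with the obvious morphisms). A square of functors $\mathsf D\to\mathsf A\xrightarrow{F}\mathsf C$, $\mathsf D\to\mathsf B\xrightarrow{G}\mathsf C$ commuting up to a fixed natural isomorphism is a pseudopullback diagram if the induced comparison functor $\mathsf D\to\mathsf P$ is an equivalence of categories. *)

(* Defs.v *)
From HB Require Import structures.
From mathcomp Require Import all_boot all_order all_algebra finmap.
From mathcomp Require Import boolp classical_sets functions cardinality.
From mathcomp Require Import topology tvs.
From mathcomp Require summability.

Set Implicit Arguments.
Unset Strict Implicit.
Unset Printing Implicit Defensive.

Import GRing.Theory.
Local Open Scope classical_set_scope.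
Local Open Scope ring_scope.

(* The underlying rings are [pzRingType]s, so that the zero ring is allowed. *)
HB.mixin Record TopologicalZmodule_isTopologicalRing R
    & TopologicalZmodule R & GRing.PzRing R := {
  mul_continuous : continuous (fun x : R * R => x.1 * x.2)
}.

#[short(type="topologicalRingType")]
HB.structure Definition TopologicalRing :=
  {R of TopologicalZmodule R & GRing.PzRing R
      & TopologicalZmodule_isTopologicalRing R}.

Section Ideals.
Context {R : pzRingType}.
Implicit Type A : set R.

Definition additive_subgroup A := A 0 /\ forall x y, A x -> A y -> A (x - y).

Definition right_ideal A :=
  additive_subgroup A /\ forall x a, A x -> A (x * a).

Definition left_ideal A :=
  additive_subgroup A /\ forall a x, A x -> A (a * x).

Definition two_sided_ideal A := left_ideal A /\ right_ideal A.

Definition right_ideal_generated A : set R := smallest right_ideal A.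

Definition coset (A : set R) (a : R) : set R := [set a + x | x in A].

End Ideals.

Definition open_subgroup (R : topologicalRingType) (U : set R) :=
  open U /\ additive_subgroup U.

Definition open_right_ideal (R : topologicalRingType) (I : set R) :=
  open I /\ right_ideal I.

Definition open_two_sided_ideal (R : topologicalRingType) (I : set R) :=
  open I /\ two_sided_ideal I.

Definition nbhs0_base (R : topologicalRingType) (B : set (set R)) :=
  B `<=` nbhs (0 : R) /\
  forall N, nbhs (0 : R) N -> exists2 A, B A & A `<=` N.

Definition countable_nbhs0_base (R : topologicalRingType) :=
  exists2 B : set (set R), countable B & nbhs0_base B.

HB.mixin Record TopologicalRing_isTwoSidedLinear R & TopologicalRing R := {
  two_sided_linear : nbhs0_base (@open_two_sided_ideal R)
}.

#[short(type="linearRingType")]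
HB.structure Definition LinearRing :=
  {R of TopologicalRing R & TopologicalRing_isTwoSidedLinear R}.

(* An element of the projective limit of the R / U, over all open subgroups U:
   a choice of one coset of each U.  For V contained in U the projection
   R / V -> R / U sends a coset of V to the unique coset of U containing it. *)
Record quotients_limit (R : topologicalRingType) := QuotientsLimit {
  ql_coset : {U : set R | open_subgroup U} -> set R;
  ql_cosetP : forall U, exists a, ql_coset U = coset (sval U) a;
  ql_compat : forall U V,
    sval V `<=` sval U -> ql_coset V `<=` ql_coset U
}.

Program Definition to_quotients_limit (R : topologicalRingType) (a : R) :
    quotients_limit R :=
  @QuotientsLimit R (fun U => coset (sval U) a) _ _.
Next Obligation. by move=> R a U; exists a. Qed.
Next Obligation. by move=> R a U V VU _ [x Vx <-]; exists x => //; apply: VU. Qed.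

Definition complete_separated (R : topologicalRingType) :=
  bijective (@to_quotients_limit R).

HB.mixin Record LinearRing_isCompleteSeparated R & LinearRing R := {
  is_complete_separated : complete_separated R
}.

#[short(type="completeLinearRingType")]
HB.structure Definition CompleteLinearRing :=
  {R of LinearRing R & LinearRing_isCompleteSeparated R}.

Definition strongly_right_taut (R S : linearRingType) (f : R -> S) :=
  nbhs0_base [set I : set R | open_two_sided_ideal I /\
    open_two_sided_ideal (closure (right_ideal_generated (f @` I)))].

Lemma quotients_limit_eq (R : topologicalRingType) (q q' : quotients_limit R) :
  ql_coset q =1 ql_coset q' -> q = q'.
Proof.
case: q q' => [q q1 q2] [q' q1' q2'] /= /funext E.
move: q1 q2; rewrite E => q1 q2.
by rewrite (Prop_irrelevance q1 q1') (Prop_irrelevance q2 q2').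
Qed.

Definition converges_to_zero (R : topologicalRingType) (X : Type)
    (r : X -> R) :=
  forall U : set R, open_subgroup U -> finite_set [set x | ~ U (r x)].

(* The limit of the finite partial sums along the directed set of finite
   subsets of X; it is 0 if there is no limit. *)
Definition infinite_sum (R : topologicalRingType) (X : choiceType)
    (r : X -> R) : R :=
  xget 0 [set s | summability.partial_sum r @ summability.totally --> s].

Section SubgroupTheory.
Context {R : pzRingType}.
Variables (A : set R) (sA : additive_subgroup A).

Lemma subg0 : A 0. Proof. by case: sA. Qed.

Lemma subgB x y : A x -> A y -> A (x - y).
Proof. by case: sA => _; apply. Qed.

Lemma subgN x : A x -> A (- x).
Proof. by move=> Ax; rewrite -sub0r; apply: subgB => //; apply: subg0. Qed.

Lemma subgD x y : A x -> A y -> A (x + y).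
Proof. by move=> Ax Ay; rewrite -[y]opprK; apply: subgB => //; apply: subgN. Qed.

Lemma subg_sum (I : Type) (s : seq I) (P : pred I) (F : I -> R) :
  (forall i, P i -> A (F i)) -> A (\sum_(i <- s | P i) F i).
Proof.
by move=> AF; elim/big_rec: _ => [|i x Pi Ax]; [apply: subg0|apply/subgD/Ax/AF].
Qed.

Lemma subg_sub_sym x y : A (x - y) -> A (y - x).
Proof. by move=> Axy; rewrite -opprB; apply: subgN. Qed.

Lemma subg_sub_trans y x z : A (x - y) -> A (y - z) -> A (x - z).
Proof. by move=> Axy Ayz; rewrite -(subrKA y); apply: subgD. Qed.

Lemma subg_sub_l x y : A (x - y) -> A y -> A x.
Proof. by move=> Axy Ay; rewrite -(subrK y x); apply: subgD. Qed.

End SubgroupTheory.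

Lemma two_sided_subgroup (R : pzRingType) (I : set R) :
  two_sided_ideal I -> additive_subgroup I.
Proof. by case=> [] []. Qed.

Lemma two_sidedMl (R : pzRingType) (I : set R) a x :
  two_sided_ideal I -> I x -> I (a * x).
Proof. by case=> [] [_ H] _; apply: H. Qed.

Lemma two_sidedMr (R : pzRingType) (I : set R) x a :
  two_sided_ideal I -> I x -> I (x * a).
Proof. by case=> [] _ [_ H]; apply: H. Qed.

Lemma open_two_sided_subgroup (R : topologicalRingType) (I : set R) :
  open_two_sided_ideal I -> open_subgroup I.
Proof. by case=> oI /two_sided_subgroup. Qed.

Lemma open_right_subgroup (R : topologicalRingType) (I : set R) :
  open_right_ideal I -> open_subgroup I.
Proof. by case=> oI []. Qed.

Lemma nbhs_addl (R : topologicalRingType) (s z : R) (A : set R) :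
  nbhs (s + z) A -> nbhs z [set x | A (s + x)].
Proof.
move=> nA; have : continuous (fun x : R => s + x); last exact.
move=> x; apply: (@continuous_comp _ _ _ (fun x => (s, x))
  (fun x : R * R => x.1 + x.2)); last exact: add_continuous.
by apply: cvg_pair; [exact: cvg_cst|exact: cvg_id].
Qed.

Section SumTheory.
Context {R : completeLinearRingType}.

Lemma separated_eq0 (s : R) :
  (forall I : set R, open_two_sided_ideal I -> I s) -> s = 0.
Proof.
move=> Is; have [g gK _] := @is_complete_separated R.
have sU U : open_subgroup U -> U s.
  case=> oU [U0 _].
  have [I [oI tI] IU] := (two_sided_linear (s := R)).2 U (open_nbhs_nbhs (conj oU U0)).
  by apply: IU; apply: Is.
rewrite -(gK s) -(gK 0); congr g; apply: quotients_limit_eq => -[U oU] /=.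
have Us := sU U oU; have aU := oU.2.
apply/seteqP; split=> [_ [x Ux <-]|_ [x Ux <-]].
  by exists (s + x); [exact: (subgD aU)|rewrite add0r].
exists (x - s); [exact: (subgB aU)|by rewrite add0r addrC subrK].
Qed.

Lemma separated_eq (s t : R) :
  (forall I : set R, open_two_sided_ideal I -> I (s - t)) -> s = t.
Proof. by move=> H; apply/subr0_eq/separated_eq0. Qed.

Lemma linear_ideal (U : set R) : open_subgroup U ->
  exists2 I : set R, open_two_sided_ideal I & I `<=` U.
Proof.
case=> oU [U0 _].
exact: (two_sided_linear (s := R)).2 U (open_nbhs_nbhs (conj oU U0)).
Qed.

Variable (X : choiceType).
Implicit Types (r : X -> R) (F : {fset X}).

Lemma partial_sumE r F : summability.partial_sum r F = \sum_(x <- F) r x.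
Proof. by rewrite /summability.partial_sum big_seq_fsetE. Qed.

Lemma partial_sum_mod U r F G : additive_subgroup U ->
  (forall x, x \notin F -> U (r x)) -> (F `<=` G)%fset ->
  U (\sum_(x <- G) r x - \sum_(x <- F) r x).
Proof.
move=> aU FU /fsubsetP FG; rewrite (big_fsetID _ (mem F) G) /=.
have -> : [fset x in G | x \in F]%fset = F.
  apply/fsetP => x; rewrite !inE /=; apply/andP/idP => [[]//|xF].
  by split=> //; apply: FG.
rewrite addrC addrK big_seq; apply: (subg_sum aU) => x.
by rewrite !inE /= => /andP[_]; apply: FU.
Qed.

Lemma finite_coset_supp (r : X -> R) U : converges_to_zero r -> open_subgroup U ->
  exists F : {fset X}, forall x, x \notin F -> U (r x).
Proof.
move=> r0 /r0 fU; exists (fset_set [set x | ~ U (r x)]) => x.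
by rewrite in_fset_set // => /negP; rewrite inE /= => /contrapT.
Qed.

Lemma finite_supp_converges (r : X -> R) :
  (forall U : set R, open_subgroup U ->
    exists F : {fset X}, forall x, x \notin F -> U (r x)) ->
  converges_to_zero r.
Proof.
move=> H U /H[F FU]; apply: (@sub_finite_set _ _ [set` F]) => // x /= nU.
by apply/negPn/negP => /FU.
Qed.

Lemma sum_exists r : converges_to_zero r ->
  exists s : R, summability.partial_sum r @ summability.totally --> s.
Proof.
move=> r0; have [g _ gK] := @is_complete_separated R.
have /choice[F FP] : forall V : {V : set R | open_subgroup V},
    exists F : {fset X}, forall x, x \notin F -> sval V (r x).
  by move=> V; apply: finite_coset_supp (svalP V).
pose c V := \sum_(x <- F V) r x.
have cc U V : sval V `<=` sval U ->
    coset (sval V) (c V) `<=` coset (sval U) (c U).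
  move=> VU _ [x Vx <-].
  have [[_ aU] [_ aV]] := (svalP U, svalP V).
  exists (c V - c U + x); last by rewrite addrA addrCA subrr addr0.
  apply: (subgD aU) (VU _ Vx).
  pose G := (F U `|` F V)%fset.
  apply: (subg_sub_trans aU (y := \sum_(x <- G) r x)).
    apply: (subg_sub_sym aU); apply: VU.
    by apply: partial_sum_mod (FP V) _; rewrite ?fsubsetUr.
  by apply: partial_sum_mod (FP U) _; rewrite ?fsubsetUl.
pose q := @QuotientsLimit R (fun V => coset (sval V) (c V))
  (fun V => ex_intro _ (c V) erefl) cc.
exists (g q) => A /= nA.
have := gK q => /(congr1 (fun z => ql_coset z)) /= E.
have /nbhs_addl nA0 : nbhs (g q + 0) A by rewrite addr0.
have [I oI IA] := (two_sided_linear (s := R)).2 _ nA0.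
have oJ := open_two_sided_subgroup oI; have aI := oJ.2.
pose J : {V : set R | open_subgroup V} := exist _ I oJ.
have /= EJ := congr1 (fun z => z J) E.
have : coset I (c J) (c J + 0) by exists 0 => //; apply: (subg0 aI).
rewrite addr0 -EJ => -[y Iy yE].
exists (F J) => // G /= FG; rewrite -[_ G](subrKC (g q)).
apply: IA; rewrite partial_sumE.
apply: (subg_sub_trans aI (y := c J)).
  exact: partial_sum_mod (FP J) FG.
by rewrite -yE addrC addKr.
Qed.

Lemma infinite_sumP r : converges_to_zero r ->
  summability.partial_sum r @ summability.totally --> infinite_sum r.
Proof. by move=> /sum_exists; apply: xgetPex. Qed.

Lemma infinite_sum_mod r U F : converges_to_zero r -> open_subgroup U ->
  (forall x, x \notin F -> U (r x)) -> U (infinite_sum r - \sum_(x <- F) r x).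
Proof.
move=> /infinite_sumP r0 [oU aU] FU.
set t := infinite_sum r in r0 *.
have nU : nbhs t [set z | U (- t + z)].
  apply: nbhs_addl; rewrite addNr; apply: open_nbhs_nbhs.
  by split=> //; apply: (subg0 aU).
have [G _ GU] := r0 _ nU.
have := GU (G `|` F)%fset (fsubsetUl _ _); rewrite /= partial_sumE addrC => tU.
apply: (subg_sub_trans aU) (partial_sum_mod aU FU (fsubsetUr G F)).
exact: (subg_sub_sym aU).
Qed.

Lemma infinite_sum_sub r U : converges_to_zero r -> open_subgroup U ->
  (forall x, U (r x)) -> U (infinite_sum r).
Proof.
move=> r0 oU rU; have := infinite_sum_mod (F := fset0) r0 oU (fun x _ => rU x).
by rewrite big_seq_fset0 subr0.
Qed.

End SumTheory.

Definition converges_to_zero_pred (R : topologicalRingType) (X : choiceType) :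
    {pred X -> R^o} :=
  fun r => `[< converges_to_zero (r : X -> R) >].

(* formal_comb R X is R[[X]]; it is a left R-module coefficientwise. *)
Record formal_comb (R : topologicalRingType) (X : choiceType) := FormalComb {
  coef :> X -> R^o;
  coef_converges_subproof : coef \in @converges_to_zero_pred R X
}.

HB.instance Definition _ (R : topologicalRingType) (X : choiceType) :=
  [isSub for @coef R X].
HB.instance Definition _ (R : topologicalRingType) (X : choiceType) :=
  [Choice of formal_comb R X by <:].

Lemma open_subgroup_dilate (R : topologicalRingType) (a : R) (U : set R) :
  open_subgroup U -> open_subgroup [set x | U (a * x)].
Proof.
move=> [oU aU]; split; last first.
  split=> [|x y /= Ux Uy]; first by rewrite /= mulr0; apply: subg0.
  by rewrite mulrBr; apply: subgB.
apply: (open_comp (f := fun x : R => a * x)) oU => x _.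
apply: (@continuous_comp _ _ _ (fun x => (a, x)) (fun x : R * R => x.1 * x.2)).
  by apply: cvg_pair; [exact: cvg_cst|exact: cvg_id].
exact: mul_continuous.
Qed.

Lemma converges_to_zeroD (R : topologicalRingType) (X : Type) (r s : X -> R) :
  converges_to_zero r -> converges_to_zero s ->
  converges_to_zero (fun x => r x + s x).
Proof.
move=> r0 s0 U oU.
apply: (@sub_finite_set _ _ ([set x | ~ U (r x)] `|` [set x | ~ U (s x)])).
  move=> x /= nU; apply/not_andP => -[Ur Us].
  by apply: nU; apply: subgD => //; case: oU.
by rewrite finite_setU; split; [apply: r0|apply: s0].
Qed.

Lemma converges_to_zeroZ (R : topologicalRingType) (X : Type) a (r : X -> R) :
  converges_to_zero r -> converges_to_zero (fun x => a * r x).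
Proof. by move=> r0 U /(open_subgroup_dilate a); apply: r0. Qed.

Lemma converges_to_zero_closed (R : topologicalRingType) (X : choiceType) :
  subsemimod_closed (@converges_to_zero_pred R X).
Proof.
split; last by move=> a r /asboolP r0; apply/asboolP/converges_to_zeroZ.
split; last by move=> r s /asboolP r0 /asboolP s0; apply/asboolP/converges_to_zeroD.
apply/asboolP => U [_ [U0 _]].
by rewrite [X in finite_set X](_ : _ = set0) // -subset0 => x /=.
Qed.
HB.instance Definition _ (R : topologicalRingType) (X : choiceType) :=
  GRing.SubChoice_isSubLmodule.Build R (X -> R^o) _ (formal_comb R X)
    (@converges_to_zero_closed R X).

Section FormalComb.
Context {R : topologicalRingType} {X : choiceType}.
Implicit Types (r s : formal_comb R X).

Definition mk_formal_comb (r : X -> R) (r0 : converges_to_zero r) :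
    formal_comb R X :=
  FormalComb (introT (asboolP (converges_to_zero (r : X -> R))) r0).

Lemma coef_converges r : converges_to_zero (r : X -> R).
Proof. by apply/asboolP; apply: coef_converges_subproof. Qed.

Lemma formal_comb_eq r s : (forall x, r x = s x :> R) -> r = s.
Proof. by move=> rs; apply/val_inj/funext. Qed.

Lemma coefD r s x : (r + s) x = r x + s x :> R.
Proof. by rewrite [(r + s) x](_ : _ = val (r + s) x) // raddfD. Qed.

Lemma coefZ (a : R) r x : (a *: r) x = a * r x :> R.
Proof. by rewrite [(a *: r) x](_ : _ = val (a *: r) x) // linearZ. Qed.

Lemma coef0 x : (0 : formal_comb R X) x = 0 :> R.
Proof. by rewrite [LHS](_ : _ = val (0 : formal_comb R X) x) // raddf0. Qed.

Lemma unit_converges (x : X) :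
  converges_to_zero (fun y => (y == x)%:R : R).
Proof.
move=> U [_ [U0 _]]; apply: (@sub_finite_set _ _ [set x]) => // y /=.
by case: eqP.
Qed.

(* The formal combination 1 x. *)
Definition comb_unit (x : X) : formal_comb R X :=
  mk_formal_comb (unit_converges x).

End FormalComb.

Section Monad.
Context {R : completeLinearRingType}.

Lemma mulr_converges (X : Type) (r k : X -> R) :
  converges_to_zero r -> converges_to_zero (fun x => r x * k x).
Proof.
move=> r0 U oU; have [I oI IU] := linear_ideal oU.
apply: sub_finite_set (r0 I (open_two_sided_subgroup oI)) => x /= nU Ir.
by apply: nU; apply: IU; apply: two_sidedMr => //; case: oI.
Qed.

Lemma restrict_converges (X : Type) (r : X -> R) (p : pred X) :
  converges_to_zero r -> converges_to_zero (fun x => if p x then r x else 0).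
Proof.
move=> r0 U oU; apply: sub_finite_set (r0 U oU) => x /=.
by case: (p x) => // nU0; case: nU0; apply: subg0; case: oU.
Qed.

Lemma map_converges (X Y : choiceType) (g : X -> Y) (r : formal_comb R X) :
  converges_to_zero
    (fun y => infinite_sum (fun x => if g x == y then r x : R else 0)).
Proof.
apply: finite_supp_converges => U oU.
have [F FU] := finite_coset_supp (coef_converges r) oU.
exists (g @` F)%fset => y yF; apply: infinite_sum_sub => // [|x].
  exact/restrict_converges/coef_converges.
case: eqP => [gx|_]; last by apply: subg0; case: oU.
by apply: FU; apply: contra yF => xF; rewrite -gx in_imfset.
Qed.

(* R[[g]]: the coefficient of y is the sum of the r x with g x = y. *)
Definition comb_map (X Y : choiceType) (g : X -> Y) (r : formal_comb R X) :
    formal_comb R Y :=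
  mk_formal_comb (map_converges g r).

Lemma bind_converges (X Y : choiceType) (k : X -> formal_comb R Y)
    (r : formal_comb R X) :
  converges_to_zero (fun y => infinite_sum (fun x => (r x : R) * k x y)).
Proof.
apply: finite_supp_converges => U /linear_ideal[I oI IU].
have oJ := open_two_sided_subgroup oI.
have [F FI] := finite_coset_supp (coef_converges r) oJ.
have /choice[G GI] : forall x, exists G : {fset Y},
    forall y, y \notin G -> I (k x y : R).
  by move=> x; apply: finite_coset_supp oJ; apply: coef_converges.
exists (\bigcup_(x <- F) G x)%fset => y yG; apply: IU.
apply: infinite_sum_sub => // [|x]; first exact/mulr_converges/coef_converges.
have [xF|/FI] := boolP (x \in F); last by apply: two_sidedMr; case: oI.
apply: two_sidedMl; first by case: oI.
apply: GI; apply: contra yG => yG; apply/bigfcupP; exists x => //.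
by rewrite xF.
Qed.

(* Kleisli extension of k; opening of parentheses is the case where k is the
   identity. *)
Definition comb_bind (X Y : choiceType) (k : X -> formal_comb R Y)
    (r : formal_comb R X) : formal_comb R Y :=
  mk_formal_comb (bind_converges k r).

Lemma comb_bindE (X Y : choiceType) (k : X -> formal_comb R Y)
    (r : formal_comb R X) y :
  comb_bind k r y = infinite_sum (fun x => (r x : R) * k x y) :> R.
Proof. by []. Qed.

(* Opening of parentheses: the coefficient of x in the image of c is the sum
   of the products c r * r x over all r in R[[X]]. *)
Definition comb_join (X : choiceType) (c : formal_comb R (formal_comb R X)) :
    formal_comb R X :=
  comb_bind id c.

Lemma comb_mapE (X Y : choiceType) (g : X -> Y) (r : formal_comb R X) :
  comb_map g r = comb_bind (fun x => comb_unit (g x)) r.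
Proof.
apply: formal_comb_eq => y /=; congr infinite_sum; apply/funext => x /=.
by rewrite eq_sym; case: eqP; rewrite ?mulr1 ?mulr0.
Qed.

Lemma infinite_sum_eq (X : choiceType) (r : X -> R) (s : R) :
  converges_to_zero r ->
  (forall I : set R, open_two_sided_ideal I -> exists2 F : {fset X},
    (forall x, x \notin F -> I (r x)) & I (\sum_(x <- F) r x - s)) ->
  infinite_sum r = s.
Proof.
move=> r0 H; apply: separated_eq => I oI; have [F FI Is] := H I oI.
have oJ := open_two_sided_subgroup oI.
apply: (subg_sub_trans oJ.2) Is; exact: infinite_sum_mod.
Qed.

Lemma infinite_sum1 (X : choiceType) (r : X -> R) (x : X) :
  (forall y, y != x -> r y = 0) -> infinite_sum r = r x.
Proof.
move=> rx; apply: infinite_sum_eq => [|I oI].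
  move=> U [_ aU]; apply: (@sub_finite_set _ _ [set x]) => // y /= nU.
  by apply: contrapT => /eqP /rx E; apply: nU; rewrite E; apply: subg0.
have aI := (open_two_sided_subgroup oI).2.
exists [fset x]%fset => [y|].
  by rewrite inE => /rx ->; apply: subg0.
by rewrite big_seq_fset1 subrr; apply: subg0.
Qed.

Lemma comb_bind_unit (X Y : choiceType) (k : X -> formal_comb R Y) (x : X) :
  comb_bind k (comb_unit x) = k x.
Proof.
apply: formal_comb_eq => y /=; rewrite (infinite_sum1 (x := x)) /=.
  by rewrite eqxx mul1r.
by move=> z /negPf ->; rewrite mul0r.
Qed.

Lemma comb_bind_id (X : choiceType) (r : formal_comb R X) :
  comb_bind comb_unit r = r.
Proof.
apply: formal_comb_eq => y /=; rewrite (infinite_sum1 (x := y)) /=.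
  by rewrite eqxx mulr1.
by move=> z /negPf zy; rewrite eq_sym zy mulr0.
Qed.

Lemma comb_bindA (X Y Z : choiceType) (l : X -> formal_comb R Y)
    (k : Y -> formal_comb R Z) (r : formal_comb R X) :
  comb_bind k (comb_bind l r) = comb_bind (fun x => comb_bind k (l x)) r.
Proof.
apply: formal_comb_eq => z /=.
apply: separated_eq => I oI.
have oJ := open_two_sided_subgroup oI; have [aI tI] := (oJ.2, oI.2).
have [F FI] := finite_coset_supp (coef_converges r) oJ.
have /choice[G GI] : forall x, exists G : {fset Y},
    forall y, y \notin G -> I (l x y : R).
  by move=> x; apply: finite_coset_supp oJ; apply: coef_converges.
pose H := (\bigcup_(x <- F) G x)%fset.
have HI x y : x \in F -> y \notin H -> I (l x y).
  move=> xF yH; apply: GI; apply: contra yH => yG.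
  by apply/bigfcupP; exists x; rewrite ?xF.
have lrI y : I (infinite_sum (fun x => (r x : R) * l x y) -
    \sum_(x <- F) (r x : R) * l x y).
  apply: infinite_sum_mod => // [|x /FI]; last exact: two_sidedMr.
  exact/mulr_converges/coef_converges.
have lr0 y : y \notin H -> I (infinite_sum (fun x => (r x : R) * l x y)).
  move=> yH; apply: (subg_sub_l aI (lrI y)).
  rewrite big_seq; apply: (subg_sum aI) => x xF.
  by apply: two_sidedMl => //; apply: HI.
apply: (subg_sub_trans aI
  (y := \sum_(y <- H) infinite_sum (fun x => (r x : R) * l x y) * k y z)).
  apply: infinite_sum_mod => // [|y /lr0]; last exact: two_sidedMr.
  exact/mulr_converges/(coef_converges (comb_bind l r)).
apply: (subg_sub_trans aI
  (y := \sum_(x <- F) (r x : R) * infinite_sum (fun y => (l x y : R) * k y z)));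
  last first.
  apply: (subg_sub_sym aI); apply: infinite_sum_mod => // [|x /FI]; last exact: two_sidedMr.
  exact/mulr_converges/coef_converges.
apply: (subg_sub_trans aI
  (y := \sum_(y <- H) \sum_(x <- F) (r x : R) * l x y * k y z)).
  rewrite -sumrB; apply: (subg_sum aI) => y _.
  by rewrite -mulr_suml -mulrBl; apply: two_sidedMr.
rewrite exchange_big /= -sumrB big_seq; apply: (subg_sum aI) => x xF.
under eq_bigr do rewrite -mulrA.
rewrite -mulr_sumr -mulrBr; apply: two_sidedMl => //.
apply: (subg_sub_sym aI); apply: infinite_sum_mod => // [|y yH].
  exact/mulr_converges/coef_converges.
by apply: two_sidedMr => //; apply: HI.
Qed.

Lemma infinite_sumD (X : choiceType) (r s : X -> R) :
  converges_to_zero r -> converges_to_zero s ->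
  infinite_sum (fun x => r x + s x) = infinite_sum r + infinite_sum s.
Proof.
move=> r0 s0; apply: infinite_sum_eq => [|I oI]; first exact: converges_to_zeroD.
have oJ := open_two_sided_subgroup oI; have aI := oJ.2.
have [F FI] := finite_coset_supp r0 oJ.
have [G GI] := finite_coset_supp s0 oJ.
have {}FI x : x \notin (F `|` G)%fset -> I (r x).
  by rewrite inE negb_or => /andP[/FI].
have {}GI x : x \notin (F `|` G)%fset -> I (s x).
  by rewrite inE negb_or => /andP[_ /GI].
exists (F `|` G)%fset => [x xFG|].
  by apply: subgD => //; [apply: FI|apply: GI].
rewrite big_split /= opprD addrACA; apply: (subgD aI).
  by apply: (subg_sub_sym aI); apply: infinite_sum_mod r0 oJ FI.
by apply: (subg_sub_sym aI); apply: infinite_sum_mod s0 oJ GI.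
Qed.

Lemma infinite_sumZ (X : choiceType) a (r : X -> R) :
  converges_to_zero r -> infinite_sum (fun x => a * r x) = a * infinite_sum r.
Proof.
move=> r0; apply: infinite_sum_eq => [|I oI]; first exact: converges_to_zeroZ.
have oJ := open_two_sided_subgroup oI; have aI := oJ.2.
have [F FI] := finite_coset_supp r0 oJ.
exists F => [x /FI|]; first by apply: two_sidedMl; case: oI.
rewrite -mulr_sumr -mulrBr; apply: two_sidedMl; first by case: oI.
by apply: (subg_sub_sym aI); apply: infinite_sum_mod r0 oJ FI.
Qed.

Lemma comb_bindD (X Y : choiceType) (k : X -> formal_comb R Y)
    (r s : formal_comb R X) :
  comb_bind k (r + s) = comb_bind k r + comb_bind k s.
Proof.
apply: formal_comb_eq => y; rewrite coefD !comb_bindE -infinite_sumD.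
- by congr infinite_sum; apply/funext => x; rewrite coefD mulrDl.
- exact/mulr_converges/coef_converges.
- exact/mulr_converges/coef_converges.
Qed.

Lemma comb_bindZ (X Y : choiceType) (k : X -> formal_comb R Y) (a : R)
    (r : formal_comb R X) :
  comb_bind k (a *: r) = a *: comb_bind k r.
Proof.
apply: formal_comb_eq => y; rewrite coefZ !comb_bindE -infinite_sumZ.
  by congr infinite_sum; apply/funext => x; rewrite coefZ mulrA.
exact/mulr_converges/coef_converges.
Qed.

End Monad.

Record category := Category {
  obj :> Type;
  hom : obj -> obj -> Type;
  idm : forall a, hom a a;
  compm : forall a b c, hom b c -> hom a b -> hom a c;
  comp1m : forall a b (u : hom a b), compm (idm b) u = u;
  compm1 : forall a b (u : hom a b), compm u (idm a) = u;
  compmA : forall a b c d (w : hom c d) (v : hom b c) (u : hom a b),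
    compm w (compm v u) = compm (compm w v) u
}.

Record functor (C D : category) := Functor {
  fobj :> C -> D;
  fmap : forall a b, hom a b -> hom (fobj a) (fobj b);
  fmap1 : forall a, fmap (idm a) = idm (fobj a);
  fmapM : forall a b c (v : hom b c) (u : hom a b),
    fmap (compm v u) = compm (fmap v) (fmap u)
}.

Definition id_functor (C : category) : functor C C :=
  @Functor C C id (fun _ _ u => u) (fun _ => erefl) (fun _ _ _ _ _ => erefl).

Program Definition comp_functor (C D E : category)
    (G : functor D E) (F : functor C D) : functor C E :=
  @Functor C E (fun a => G (F a)) (fun a b u => fmap G (fmap F u)) _ _.
Next Obligation. by move=> C D E G F a /=; rewrite !fmap1. Qed.
Next Obligation. by move=> C D E G F a b c v u /=; rewrite !fmapM. Qed.

Definition fully_faithful (C D : category) (F : functor C D) :=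
  forall a b : C, bijective (@fmap C D F a b).

Record iso (C : category) (a b : C) := Iso {
  iso_hom : hom a b;
  iso_inv : hom b a;
  iso_homK : compm iso_inv iso_hom = idm a;
  iso_invK : compm iso_hom iso_inv = idm b
}.

Record natural_iso (C D : category) (F G : functor C D) := NaturalIso {
  natiso : forall a, iso (F a) (G a);
  natisoP : forall a b (u : hom a b),
    compm (fmap G u) (iso_hom (natiso a)) =
    compm (iso_hom (natiso b)) (fmap F u)
}.

Definition is_equivalence (C D : category) (F : functor C D) :=
  exists G : functor D C,
    inhabited (natural_iso (comp_functor G F) (id_functor C)) /\
    inhabited (natural_iso (comp_functor F G) (id_functor D)).

Definition full_subcategory (C : category) (p : C -> Prop) : category :=
  @Category {a : C | p a} (fun a b => hom (sval a) (sval b))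
    (fun a => idm (sval a)) (fun _ _ _ v u => compm v u)
    (fun _ _ u => comp1m u) (fun _ _ u => compm1 u)
    (fun _ _ _ _ w v u => compmA w v u).

Definition inclusion_functor (C : category) (p : C -> Prop) :
    functor (full_subcategory p) C :=
  @Functor (full_subcategory p) C sval (fun _ _ u => u)
    (fun _ => erefl) (fun _ _ _ _ _ => erefl).

Definition restrict_functor (C D : category) (p : C -> Prop) (q : D -> Prop)
    (F : functor C D) (pq : forall a, p a -> q (F a)) :
    functor (full_subcategory p) (full_subcategory q) :=
  @Functor (full_subcategory p) (full_subcategory q)
    (fun a => exist q (F (sval a)) (pq _ (svalP a)))
    (fun _ _ u => fmap F u)
    (fun a => fmap1 F (sval a)) (fun _ _ _ v u => fmapM F v u).

Section Pseudopullback.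
Context {A B C : category} (F : functor A C) (G : functor B C).

Record pseudopullback_obj := PseudopullbackObj {
  pp_fst : A;
  pp_snd : B;
  pp_iso : iso (F pp_fst) (G pp_snd)
}.

Record pseudopullback_hom (x y : pseudopullback_obj) := PseudopullbackHom {
  pph_fst : hom (pp_fst x) (pp_fst y);
  pph_snd : hom (pp_snd x) (pp_snd y);
  pph_comm : compm (fmap G pph_snd) (iso_hom (pp_iso x)) =
             compm (iso_hom (pp_iso y)) (fmap F pph_fst)
}.

Lemma pseudopullback_hom_eq x y (u v : pseudopullback_hom x y) :
  pph_fst u = pph_fst v -> pph_snd u = pph_snd v -> u = v.
Proof.
case: u v => u1 u2 uP [v1 v2 vP] /= E1 E2; move: uP; rewrite E1 E2 => uP.
by rewrite (Prop_irrelevance uP vP).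
Qed.

Program Definition pseudopullback_id x : pseudopullback_hom x x :=
  @PseudopullbackHom x x (idm _) (idm _) _.
Next Obligation. by move=> x /=; rewrite !fmap1 comp1m compm1. Qed.

Program Definition pseudopullback_comp x y z (v : pseudopullback_hom y z)
    (u : pseudopullback_hom x y) : pseudopullback_hom x z :=
  @PseudopullbackHom x z (compm (pph_fst v) (pph_fst u))
    (compm (pph_snd v) (pph_snd u)) _.
Next Obligation.
by move=> x y z v u /=; rewrite !fmapM -compmA pph_comm !compmA pph_comm.
Qed.

Program Definition pseudopullback : category :=
  @Category pseudopullback_obj pseudopullback_hom pseudopullback_id
    pseudopullback_comp _ _ _.
Next Obligation.
by move=> x y u; apply: pseudopullback_hom_eq; rewrite /= comp1m.
Qed.
Next Obligation.
by move=> x y u; apply: pseudopullback_hom_eq; rewrite /= compm1.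
Qed.
Next Obligation.
by move=> x y z t w v u; apply: pseudopullback_hom_eq; rewrite /= compmA.
Qed.

Context {D : category} (H : functor D A) (K : functor D B).
Variable alpha : natural_iso (comp_functor F H) (comp_functor G K).

Program Definition pseudopullback_comparison : functor D pseudopullback :=
  @Functor D pseudopullback
    (fun d => @PseudopullbackObj (H d) (K d) (natiso alpha d))
    (fun d e u => @PseudopullbackHom _ _ (fmap H u) (fmap K u) _) _ _.
Next Obligation. by move=> d e u; apply: (natisoP alpha). Qed.
Next Obligation.
by move=> d; apply: pseudopullback_hom_eq; rewrite /= fmap1.
Qed.
Next Obligation.
by move=> d e g v u; apply: pseudopullback_hom_eq; rewrite /= fmapM.
Qed.

(* The square with sides H, K, F, G, commuting up to alpha. *)
Definition is_pseudopullback := is_equivalence pseudopullback_comparison.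

End Pseudopullback.
Arguments is_pseudopullback {A B C} F G {D} H K alpha.

Lemma linear_hom_eq (R : pzRingType) (M N : lmodType R)
    (u v : {linear M -> N}) : u =1 v -> u = v.
Proof.
move=> /funext; case: u v => [u [[uD] [uZ]]] [v [[vD] [vZ]]] /= uv.
move: uD uZ; rewrite uv => uD uZ.
by rewrite (Prop_irrelevance uD vD) (Prop_irrelevance uZ vZ).
Qed.

Program Definition lmod_category (R : pzRingType) : category :=
  @Category (lmodType R) (fun M N => {linear M -> N})
    (fun M => @idfun M) (fun M N L v u => v \o u) _ _ _.
Next Obligation. by move=> R M N u; apply: linear_hom_eq. Qed.
Next Obligation. by move=> R M N u; apply: linear_hom_eq. Qed.
Next Obligation. by move=> R M N L T w v u; apply: linear_hom_eq. Qed.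

Definition restr_lmod (R S : pzRingType) (f : {rmorphism R -> S})
    (M : lmodType S) : Type := M.

Section RestrictionOfScalars.
Context {R S : pzRingType} (f : {rmorphism R -> S}) (M : lmodType S).

HB.instance Definition _ := GRing.Zmodule.on (restr_lmod f M).

Definition restr_scale (a : R) (v : restr_lmod f M) : restr_lmod f M :=
  f a *: (v : M).

Lemma restr_scaleA a b v :
  restr_scale a (restr_scale b v) = restr_scale (a * b) v.
Proof. by rewrite /restr_scale scalerA -rmorphM. Qed.

Lemma restr_scale1 : left_id 1 restr_scale.
Proof. by move=> v; rewrite /restr_scale rmorph1 scale1r. Qed.

Lemma restr_scaleDr : right_distributive restr_scale +%R.
Proof. by move=> a u v; rewrite /restr_scale; apply: scalerDr. Qed.

Lemma restr_scaleDl v : {morph restr_scale^~ v : a b / a + b}.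
Proof. by move=> a b; rewrite /restr_scale rmorphD; apply: scalerDl. Qed.

HB.instance Definition _ := GRing.Zmodule_isLmodule.Build R (restr_lmod f M)
  restr_scaleA restr_scale1 restr_scaleDr restr_scaleDl.

End RestrictionOfScalars.

Definition restr_hom (R S : pzRingType) (f : {rmorphism R -> S})
    (M N : lmodType S) (u : {linear M -> N}) : restr_lmod f M -> restr_lmod f N :=
  u.
Arguments restr_hom {R S} f {M N} u.

Section RestrictionHom.
Context {R S : pzRingType} (f : {rmorphism R -> S}) (M N : lmodType S).
Variable u : {linear M -> N}.

Lemma restr_hom_linear : linear (restr_hom f u).
Proof. by move=> a v w; apply: (linearP u). Qed.

HB.instance Definition _ :=
  GRing.isLinear.Build R (restr_lmod f M) (restr_lmod f N) _ (restr_hom f u)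
    restr_hom_linear.

End RestrictionHom.

Program Definition restr_functor (R S : pzRingType) (f : {rmorphism R -> S}) :
    functor (lmod_category S) (lmod_category R) :=
  @Functor (lmod_category S) (lmod_category R)
    (fun M : lmodType S => restr_lmod f M)
    (fun (M N : lmodType S) (u : {linear M -> N}) => restr_hom f u) _ _.
Next Obligation. by move=> R S f M; apply: linear_hom_eq. Qed.
Next Obligation. by move=> R S f M N L v u; apply: linear_hom_eq. Qed.

(* Sets are [choiceType]s; classically every type carries that structure. *)
Record contramodule (R : completeLinearRingType) := Contramodule {
  contra_sort :> choiceType;
  contra_act : formal_comb R contra_sort -> contra_sort;
  contra_act_unit : forall x, contra_act (comb_unit x) = x;
  contra_act_join : forall c : formal_comb R (formal_comb R contra_sort),
    contra_act (comb_map contra_act c) = contra_act (comb_join c)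
}.
Arguments contra_act {R P} _ : rename.

Definition contra_lmod (R : completeLinearRingType) (P : contramodule R) : Type :=
  P.

Section UnderlyingModule.
Context {R : completeLinearRingType} (P : contramodule R).
Implicit Types (x y z : contra_lmod P) (a b : R) (r s : formal_comb R P).

HB.instance Definition _ := Choice.on (contra_lmod P).

Definition contra_unit x : formal_comb R P := comb_unit (x : P).

Definition contra_zero : contra_lmod P := contra_act (0 : formal_comb R P).

Definition contra_opp x : contra_lmod P := contra_act (- contra_unit x).

Definition contra_add x y : contra_lmod P :=
  contra_act (contra_unit x + contra_unit y).

Definition contra_scale a x : contra_lmod P := contra_act (a *: contra_unit x).

Lemma contra_unitK x : contra_act (contra_unit x) = x.
Proof. exact: contra_act_unit. Qed.

Lemma contra_actD r s :
  contra_act (r + s) = contra_add (contra_act r) (contra_act s).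
Proof.
have := contra_act_join (comb_unit r + comb_unit s).
by rewrite comb_mapE /comb_join !comb_bindD !comb_bind_unit => <-.
Qed.

Lemma contra_actZ a r : contra_act (a *: r) = contra_scale a (contra_act r).
Proof.
have := contra_act_join (a *: comb_unit r).
by rewrite comb_mapE /comb_join !comb_bindZ !comb_bind_unit => <-.
Qed.

Lemma contra_addA : associative contra_add.
Proof.
move=> x y z; rewrite -{1}(contra_unitK x) -{2}(contra_unitK z).
by rewrite -!contra_actD addrA.
Qed.

Lemma contra_addC : commutative contra_add.
Proof. by move=> x y; rewrite /contra_add addrC. Qed.

Lemma contra_add0 : left_id contra_zero contra_add.
Proof. by move=> x; rewrite -{1}(contra_unitK x) -contra_actD add0r contra_unitK. Qed.

Lemma contra_addN : left_inverse contra_zero contra_opp contra_add.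
Proof. by move=> x; rewrite -{2}(contra_unitK x) -contra_actD addNr. Qed.

HB.instance Definition _ := GRing.isZmodule.Build (contra_lmod P)
  contra_addA contra_addC contra_add0 contra_addN.

Lemma contra_scaleA a b x :
  contra_scale a (contra_scale b x) = contra_scale (a * b) x.
Proof. by rewrite -[LHS]contra_actZ scalerA. Qed.

Lemma contra_scale1 : left_id 1 contra_scale.
Proof. by move=> x; rewrite /contra_scale scale1r contra_unitK. Qed.

Lemma contra_scaleDr : right_distributive contra_scale +%R.
Proof.
by move=> a x y; rewrite -[LHS]contra_actZ scalerDr contra_actD.
Qed.

Lemma contra_scaleDl x : {morph contra_scale^~ x : a b / a + b}.
Proof. by move=> a b; rewrite /contra_scale scalerDl contra_actD. Qed.

HB.instance Definition _ := GRing.Zmodule_isLmodule.Build R (contra_lmod P)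
  contra_scaleA contra_scale1 contra_scaleDr contra_scaleDl.

Lemma contra_lmodD x y : x + y = contra_act (contra_unit x + contra_unit y).
Proof. by []. Qed.

Lemma contra_lmodZ a x : a *: x = contra_act (a *: contra_unit x).
Proof. by []. Qed.

Lemma contra_lmod0 : 0 = contra_act (0 : formal_comb R P) :> contra_lmod P.
Proof. by []. Qed.

End UnderlyingModule.

Record contra_hom (R : completeLinearRingType) (P Q : contramodule R) :=
  ContraHom {
    contra_fun :> P -> Q;
    contra_fun_act : forall r : formal_comb R P,
      contra_fun (contra_act r) = contra_act (comb_map contra_fun r)
  }.

Section ContraCategory.
Context {R : completeLinearRingType}.

Lemma contra_hom_eq (P Q : contramodule R) (u v : contra_hom P Q) :
  u =1 v -> u = v.
Proof.
case: u v => [u uP] [v vP] /= /funext uv; move: uP; rewrite uv => uP.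
by rewrite (Prop_irrelevance uP vP).
Qed.

Lemma comb_map_id (X : choiceType) (r : formal_comb R X) : comb_map id r = r.
Proof. by rewrite comb_mapE comb_bind_id. Qed.

Lemma comb_map_comp (X Y Z : choiceType) (h : Y -> Z) (g : X -> Y)
    (r : formal_comb R X) : comb_map (h \o g) r = comb_map h (comb_map g r).
Proof.
rewrite !comb_mapE comb_bindA; congr comb_bind; apply/funext => x.
by rewrite comb_bind_unit.
Qed.

Program Definition contra_id (P : contramodule R) : contra_hom P P :=
  @ContraHom R P P id _.
Next Obligation. by move=> P r; rewrite comb_map_id. Qed.

Program Definition contra_comp (P Q T : contramodule R) (v : contra_hom Q T)
    (u : contra_hom P Q) : contra_hom P T :=
  @ContraHom R P T (v \o u) _.
Next Obligation.
by move=> P Q T v u r; rewrite /= !contra_fun_act comb_map_comp.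
Qed.

End ContraCategory.

Program Definition contra_category (R : completeLinearRingType) : category :=
  @Category (contramodule R) (@contra_hom R) (@contra_id R)
    (@contra_comp R) _ _ _.
Next Obligation. by move=> R P Q u; apply: contra_hom_eq. Qed.
Next Obligation. by move=> R P Q u; apply: contra_hom_eq. Qed.
Next Obligation. by move=> R P Q T V w v u; apply: contra_hom_eq. Qed.

Definition contra_linear (R : completeLinearRingType) (P Q : contramodule R)
    (u : contra_hom P Q) : contra_lmod P -> contra_lmod Q := u.

Section ContraLinear.
Context {R : completeLinearRingType} (P Q : contramodule R).
Variable u : contra_hom P Q.

Lemma contra_linear_linear : linear (contra_linear u).
Proof.
move=> a x y; rewrite /contra_linear contra_lmodD contra_fun_act comb_mapE.
rewrite comb_bindD !comb_bind_unit contra_actD; congr (_ + _).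
  rewrite contra_act_unit contra_lmodZ contra_fun_act comb_mapE.
  by rewrite comb_bindZ comb_bind_unit.
exact: contra_act_unit.
Qed.

HB.instance Definition _ :=
  GRing.isLinear.Build R (contra_lmod P) (contra_lmod Q) _ (contra_linear u)
    contra_linear_linear.

End ContraLinear.

Program Definition contra_forget (R : completeLinearRingType) :
    functor (contra_category R) (lmod_category R) :=
  @Functor (contra_category R) (lmod_category R)
    (fun P : contramodule R => contra_lmod P)
    (fun (P Q : contramodule R) (u : contra_hom P Q) => contra_linear u) _ _.
Next Obligation. by move=> R P; apply: linear_hom_eq. Qed.
Next Obligation. by move=> R P Q T v u; apply: linear_hom_eq. Qed.

(* The subset obtained by acting with coefficients in I; it is in general
   larger than the subgroup generated by the products a x with a in I. *)
Definition contra_ideal_mul (R : completeLinearRingType) (P : contramodule R)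
    (I : set R) : set (contra_lmod P) :=
  [set contra_act r | r in [set r : formal_comb R P | forall x, I (r x)]].
Arguments contra_ideal_mul {R} P I.

Definition separated (R : completeLinearRingType) (P : contramodule R) :=
  \bigcap_(I in @open_right_ideal R) contra_ideal_mul P I = [set 0].

Definition separ_category (R : completeLinearRingType) : category :=
  @full_subcategory (contra_category R) (@separated R).

Definition separ_forget (R : completeLinearRingType) :
    functor (separ_category R) (lmod_category R) :=
  comp_functor (contra_forget R)
    (@inclusion_functor (contra_category R) (@separated R)).

Section ContraRestriction.
Context {R S : completeLinearRingType} (f : {rmorphism R -> S}).
Hypothesis fcont : continuous f.

Lemma open_subgroup_preimage (U : set S) :
  open_subgroup U -> open_subgroup (f @^-1` U).
Proof.
move=> [oU aU]; split; first by apply: open_comp oU => x _; apply: fcont.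
split=> [|x y /= Ux Uy]; first by rewrite /= rmorph0; apply: subg0.
by rewrite rmorphB; apply: subgB.
Qed.

Lemma pushforward_converges (X : Type) (r : X -> R) :
  converges_to_zero r -> converges_to_zero (fun x => f (r x)).
Proof. by move=> r0 U /open_subgroup_preimage; apply: r0. Qed.

Lemma infinite_sum_pushforward (X : choiceType) (r : X -> R) :
  converges_to_zero r -> infinite_sum (fun x => f (r x)) = f (infinite_sum r).
Proof.
move=> r0; apply: infinite_sum_eq => [|I oI]; first exact: pushforward_converges.
have oJ := open_two_sided_subgroup oI.
have oK := open_subgroup_preimage oJ.
have [F FI] := finite_coset_supp r0 oK.
exists F => [x /FI//|]; rewrite -rmorph_sum -rmorphB.
by apply: (subg_sub_sym oK.2); apply: infinite_sum_mod r0 oK FI.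
Qed.

(* The map R[[X]] -> S[[X]] induced by f. *)
Definition comb_pushforward (X : choiceType) (r : formal_comb R X) :
    formal_comb S X :=
  mk_formal_comb (pushforward_converges (coef_converges r)).

Lemma comb_pushforward_unit (X : choiceType) (x : X) :
  comb_pushforward (comb_unit x) = comb_unit x.
Proof. by apply: formal_comb_eq => y; apply: rmorph_nat. Qed.

Lemma comb_pushforward_bind (X Y : choiceType) (k : X -> formal_comb R Y)
    (r : formal_comb R X) :
  comb_pushforward (comb_bind k r) =
  comb_bind (fun x => comb_pushforward (k x)) (comb_pushforward r).
Proof.
apply: formal_comb_eq => y /=; rewrite -infinite_sum_pushforward.
  by congr infinite_sum; apply/funext => x; rewrite rmorphM.
exact/mulr_converges/coef_converges.
Qed.

Lemma comb_pushforward_map (X Y : choiceType) (g : X -> Y)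
    (r : formal_comb R X) :
  comb_pushforward (comb_map g r) = comb_map g (comb_pushforward r).
Proof.
rewrite !comb_mapE comb_pushforward_bind; congr comb_bind.
by apply/funext => x; apply: comb_pushforward_unit.
Qed.

Definition contra_restr_act (Q : contramodule S) (r : formal_comb R Q) : Q :=
  contra_act (comb_pushforward r).

Program Definition contra_restr (Q : contramodule S) : contramodule R :=
  @Contramodule R Q (@contra_restr_act Q) _ _.
Next Obligation.
by move=> Q x; rewrite /contra_restr_act comb_pushforward_unit contra_act_unit.
Qed.
Next Obligation.
move=> Q c; rewrite /contra_restr_act comb_pushforward_map.
have -> : comb_map (@contra_restr_act Q) (comb_pushforward c) =
    comb_map contra_act (comb_map (@comb_pushforward Q) (comb_pushforward c)).
  exact: comb_map_comp.
rewrite contra_act_join /comb_join comb_pushforward_bind comb_mapE comb_bindA.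
by congr (contra_act (comb_bind _ _)); apply/funext => r; rewrite comb_bind_unit.
Qed.

Program Definition contra_restr_hom (P Q : contramodule S)
    (u : contra_hom P Q) : contra_hom (contra_restr P) (contra_restr Q) :=
  @ContraHom R (contra_restr P) (contra_restr Q) u _.
Next Obligation.
move=> P Q u r.
by rewrite /= /contra_restr_act contra_fun_act comb_pushforward_map.
Qed.

Program Definition contra_restr_functor :
    functor (contra_category S) (contra_category R) :=
  @Functor (contra_category S) (contra_category R) contra_restr
    contra_restr_hom _ _.
Next Obligation. by move=> P; apply: contra_hom_eq. Qed.
Next Obligation. by move=> P Q T v u; apply: contra_hom_eq. Qed.

Lemma comb_pushforwardD (X : choiceType) (r s : formal_comb R X) :
  comb_pushforward (r + s) = comb_pushforward r + comb_pushforward s.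
Proof.
apply: formal_comb_eq => x; rewrite coefD.
by rewrite [LHS](_ : _ = f ((r + s) x)) // coefD rmorphD.
Qed.

Lemma comb_pushforwardZ (X : choiceType) (a : R) (r : formal_comb R X) :
  comb_pushforward (a *: r) = f a *: comb_pushforward r.
Proof.
apply: formal_comb_eq => x; rewrite coefZ.
by rewrite [LHS](_ : _ = f ((a *: r) x)) // coefZ rmorphM.
Qed.

Lemma comb_pushforward0 (X : choiceType) :
  comb_pushforward (0 : formal_comb R X) = 0.
Proof. by rewrite -[0 in LHS](scale0r 0) comb_pushforwardZ rmorph0 scale0r. Qed.

Lemma contra_restr_separated (Q : contramodule S) :
  separated Q -> separated (contra_restr Q).
Proof.
move=> sQ; apply/seteqP; split=> [x xI|x -> I oI]; last first.
  exists 0 => // y; rewrite coef0.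
  by apply: subg0; exact: (open_right_subgroup oI).2.
have : [set (0 : contra_lmod Q)] x.
  rewrite -sQ => J oJ.
  have oI : open_right_ideal (f @^-1` J).
    have [oI aI] := open_subgroup_preimage (open_right_subgroup oJ).
    split=> //; split=> // y a /= Jy; rewrite rmorphM.
    by case: oJ => _ [_]; apply.
  have [r rI <-] := xI _ oI.
  by exists (comb_pushforward r).
move=> ->; rewrite /set1 /=.
by rewrite [RHS]contra_lmod0 /= /contra_restr_act comb_pushforward0.
Qed.

Definition separ_restr_functor : functor (separ_category S) (separ_category R) :=
  restrict_functor (F := contra_restr_functor) contra_restr_separated.

Section SquareOfModules.
Variable Q : contramodule S.

Definition restr_square_hom (x : restr_lmod f (contra_lmod Q)) :
  contra_lmod (contra_restr Q) := x.

Definition restr_square_inv (x : contra_lmod (contra_restr Q)) :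
  restr_lmod f (contra_lmod Q) := x.

Lemma restr_square_hom_linear : linear restr_square_hom.
Proof.
have DE (x y : Q) : (x : contra_lmod (contra_restr Q)) + y =
    (x : contra_lmod Q) + y.
  rewrite [LHS]contra_lmodD [RHS]contra_lmodD /= /contra_restr_act.
  by rewrite comb_pushforwardD !comb_pushforward_unit.
have ZE a (x : Q) : a *: (x : contra_lmod (contra_restr Q)) =
    f a *: (x : contra_lmod Q).
  rewrite [LHS]contra_lmodZ [RHS]contra_lmodZ /= /contra_restr_act.
  by rewrite comb_pushforwardZ comb_pushforward_unit.
by move=> a x y; rewrite /restr_square_hom ZE DE.
Qed.

Lemma restr_square_inv_linear : linear restr_square_inv.
Proof.
by move=> a x y; apply: esym; apply: (restr_square_hom_linear a x y).
Qed.

HB.instance Definition _ :=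
  GRing.isLinear.Build R (restr_lmod f (contra_lmod Q))
    (contra_lmod (contra_restr Q)) _ restr_square_hom restr_square_hom_linear.

HB.instance Definition _ :=
  GRing.isLinear.Build R (contra_lmod (contra_restr Q))
    (restr_lmod f (contra_lmod Q)) _ restr_square_inv restr_square_inv_linear.

Program Definition restr_square_iso : @iso (lmod_category R)
    (restr_lmod f (contra_lmod Q)) (contra_lmod (contra_restr Q)) :=
  @Iso (lmod_category R) (restr_lmod f (contra_lmod Q))
    (contra_lmod (contra_restr Q)) restr_square_hom restr_square_inv _ _.
Next Obligation. exact: linear_hom_eq. Qed.
Next Obligation. exact: linear_hom_eq. Qed.

End SquareOfModules.

(* Both composites of the square keep the underlying sets; the isomorphism
   between them is the identity map. *)
Program Definition separ_square : natural_iso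
    (comp_functor (restr_functor f) (separ_forget S))
    (comp_functor (separ_forget R) separ_restr_functor) :=
  @NaturalIso _ _ (comp_functor (restr_functor f) (separ_forget S))
    (comp_functor (separ_forget R) separ_restr_functor)
    (fun Q => restr_square_iso (sval Q)) _.
Next Obligation. by move=> P Q u; apply: linear_hom_eq. Qed.

End ContraRestriction.

(* Main.v *)
(* Let (I_n) be a decreasing base of R by ideals as in the tautness condition,
   with I_0 = R. By continuity the ideals J_n, the closures of f(I_n) S, form a
   base of S. Approximating successively, every element of S[[X]] with
   coefficients in J_n is a sum of a_k (t_k x_k) for a family (a_k) in I_n
   converging to zero, so that S[[X]] is generated, as an R-contramodule, by the
   elements t x. Hence an S-linear map of S-contramodules, which is a morphism of
   R-contramodules by hypothesis, is a morphism of S-contramodules.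

   For an S-module M whose underlying R-module is that of a separated
   R-contramodule P, applying full faithfulness to the R-linear maps S -> P,
   s |-> s x, gives J_n M <= I_n P, the right-hand side being the contramodule
   product. Since P / N is a discrete contramodule for every submodule N
   containing all a x with a in I_n, that product is spanned algebraically; so it
   is an S-submodule, and the S-contramodule structure on M is defined by limits
   of finite sums modulo these submodules. *)

Require Import Defs.
From HB Require Import structures.
From mathcomp Require Import all_boot all_order all_algebra finmap.
From mathcomp Require Import boolp classical_sets cardinality.
From mathcomp Require Import topology tvs.

Set Implicit Arguments.
Unset Strict Implicit.
Unset Printing Implicit Defensive.

Import GRing.Theory.
Local Open Scope classical_set_scope.
Local Open Scope ring_scope.

(** * Submodules and quotient modules *)

Definition is_submodule (R : pzRingType) (M : lmodType R) (N : set M) :=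
  [/\ N 0, forall x y, N x -> N y -> N (x + y) & forall a x, N x -> N (a *: x)].

Section Submodule.
Context {R : pzRingType} {M : lmodType R} {N : set M}.
Hypothesis sN : is_submodule N.

Lemma submod0 : N 0. Proof. by case: sN. Qed.

Lemma submodD x y : N x -> N y -> N (x + y).
Proof. by case: sN => _ + _; apply. Qed.

Lemma submodZ a x : N x -> N (a *: x).
Proof. by case: sN => _ _; apply. Qed.

Lemma submodB x y : N x -> N y -> N (x - y).
Proof. by move=> Nx Ny; rewrite -scaleN1r; apply/submodD/submodZ. Qed.

Lemma submod_sub_sym x y : N (x - y) -> N (y - x).
Proof. by move=> Nxy; rewrite -opprB -scaleN1r; apply: submodZ. Qed.

Lemma submod_sub_trans y x z : N (x - y) -> N (y - z) -> N (x - z).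
Proof. by move=> Nxy Nyz; rewrite -(subrKA y); apply: submodD. Qed.

Lemma submod_sum (K : Type) (l : seq K) (P : pred K) (F : K -> M) :
  (forall k, P k -> N (F k)) -> N (\sum_(k <- l | P k) F k).
Proof.
by move=> NF; elim/big_rec: _ => [|k x Pk Nx]; [apply: submod0|apply/submodD/Nx/NF].
Qed.

End Submodule.

Section QuotientModule.
Context {R : pzRingType} {M : lmodType R}.
Variable N : {N : set M | is_submodule N}.

Definition submod_pred : {pred M} := fun x => `[< sval N x >].

Lemma submod_pred_closed : subsemimod_closed submod_pred.
Proof.
split; first split.
- exact/asboolP/(submod0 (svalP N)).
- by move=> x y /asboolP Nx /asboolP Ny; apply/asboolP/(submodD (svalP N)).
- by move=> a x /asboolP Nx; apply/asboolP/(submodZ (svalP N)).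
Qed.

HB.instance Definition _ :=
  GRing.isSubmodClosed.Build R M submod_pred submod_pred_closed.

Local Notation "M/N" := (Quotient.quot submod_pred) (at level 0).
Local Open Scope quotient_scope.

Lemma quot_eq (x y : M) : (\pi_(M/N) x = \pi_(M/N) y) <-> sval N (x - y).
Proof.
transitivity (is_true ((x - y) \in submod_pred)); last by split=> /asboolP.
by rewrite Quotient.idealrBE; split=> /eqP.
Qed.

Definition quot_scale (a : R) (q : M/N) : M/N := \pi_(M/N) (a *: repr q).

Lemma pi_scale a (x : M) : quot_scale a (\pi_(M/N) x) = \pi_(M/N) (a *: x).
Proof.
apply/quot_eq; rewrite -scalerBr; apply: (submodZ (svalP N)).
by apply/quot_eq; rewrite reprK.
Qed.

Lemma quot_scaleA a b (q : M/N) :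
  quot_scale a (quot_scale b q) = quot_scale (a * b) q.
Proof.
rewrite -[q]reprK; move: (repr q) => x.
by rewrite [quot_scale b _]pi_scale !pi_scale scalerA.
Qed.

Lemma quot_scale1 : left_id 1 quot_scale.
Proof. by move=> q; rewrite -{1}[q]reprK pi_scale scale1r reprK. Qed.

Lemma quot_scaleDr : right_distributive quot_scale +%R.
Proof.
move=> a q q'; rewrite -[q]reprK -[q']reprK; move: (repr q) (repr q') => x y.
by rewrite -raddfD !pi_scale -raddfD scalerDr.
Qed.

Lemma quot_scaleDl (q : M/N) : {morph quot_scale^~ q : a b / a + b}.
Proof.
move=> a b; rewrite -[q]reprK; move: (repr q) => x.
by rewrite !pi_scale -raddfD scalerDl.
Qed.

HB.instance Definition _ := GRing.Zmodule_isLmodule.Build R M/N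
  quot_scaleA quot_scale1 quot_scaleDr quot_scaleDl.

Definition quot_proj (x : M) : M/N := \pi_(M/N) x.

Lemma quot_proj_linear : linear quot_proj.
Proof.
by move=> a x y; rewrite /quot_proj raddfD; congr (_ + _); apply/esym/pi_scale.
Qed.

HB.instance Definition _ :=
  GRing.isLinear.Build R M M/N _ quot_proj quot_proj_linear.

Lemma quot_proj_eq0 x : quot_proj x = 0 <-> sval N x.
Proof. by rewrite -{2}[x]subr0 -quot_eq raddf0. Qed.

End QuotientModule.

(** * Closures, formal combinations and convergent series *)

Lemma closure_subgroup (R : topologicalRingType) (A U : set R) s :
  open_subgroup U -> closure A s -> exists2 a, A a & U (s - a).
Proof.
move=> [oU aU] As.
have [|a [Aa /= Ua]] := As [set z | U (- s + z)].
  apply: nbhs_addl; rewrite addNr; apply: open_nbhs_nbhs.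
  by split=> //; apply: subg0.
by exists a => //; apply: (subg_sub_sym aU); rewrite addrC.
Qed.

Lemma open_subgroup_closed (R : topologicalRingType) (U : set R) :
  open_subgroup U -> closure U `<=` U.
Proof.
move=> oU s /(closure_subgroup oU)[a Ua]; move=> Usa.
exact: (subg_sub_l oU.2) Usa Ua.
Qed.

Section FormalCombinations.
Context {R : topologicalRingType} {X : choiceType}.
Implicit Types (r s : formal_comb R X) (I : set R) (F : {fset X}).

Lemma comb_coefB r s x : (r - s) x = (r x : R) - s x :> R.
Proof.
by rewrite Defs.coefD -scaleN1r Defs.coefZ mulN1r.
Qed.

Lemma comb_coef_sum (K : Type) (l : seq K) (P : pred K) (r : K -> formal_comb R X) x :
  (\sum_(k <- l | P k) r k) x = \sum_(k <- l | P k) (r k x : R) :> R.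
Proof.
by elim/big_rec2: _ => [|k a b _ <-]; [exact: Defs.coef0 | exact: Defs.coefD].
Qed.

(** Reduces identities on R[[X]] to units and small tails: additivity and linearity handle the
    finite part, and the remainder has its coefficients in an ideal as soon as [r] does outside
    [F]. *)
Lemma comb_split r F : exists s, (forall x, x \in F -> s x = 0 :> R) /\
  (forall x, x \notin F -> s x = r x :> R) /\
  r = \sum_(x <- F) (r x : R) *: comb_unit x + s.
Proof.
have E x : (\sum_(y <- F) (r y : R) *: comb_unit y) x =
    (if x \in F then r x else 0) :> R.
  rewrite comb_coef_sum; under eq_bigr do rewrite Defs.coefZ /=.
  case: ifP => [xF|/negP xF].
    rewrite (big_fsetD1 x) //= eqxx mulr1 big_seq big1 ?addr0 // => y.
    by rewrite !inE eq_sym => /andP[/negPf -> _]; rewrite mulr0.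
  rewrite big_seq big1 // => y yF; case: eqP => [xy|_]; last by rewrite mulr0.
  by case: xF; rewrite xy.
exists (r - \sum_(x <- F) (r x : R) *: comb_unit x).
split=> [x xF|]; first by rewrite comb_coefB E xF subrr.
split=> [x /negPf xF|]; first by rewrite comb_coefB E xF subr0.
by rewrite addrC subrK.
Qed.

End FormalCombinations.

Section MonadComplements.
Context {R : completeLinearRingType}.
Implicit Types (I : set R).

Lemma comb_bind_ideal (X Y : choiceType) (k : X -> formal_comb R Y)
    (r : formal_comb R X) I : open_two_sided_ideal I ->
  (forall x, I (r x)) -> forall y, I (comb_bind k r y).
Proof.
move=> oI Ir y; rewrite comb_bindE; apply: infinite_sum_sub => [||x].
- exact/mulr_converges/coef_converges.
- exact: open_two_sided_subgroup.
- by apply: two_sidedMr => //; case: oI.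
Qed.

Lemma comb_map_ideal (X Y : choiceType) (g : X -> Y) (r : formal_comb R X) I :
  open_two_sided_ideal I ->
  (forall x, I (r x)) -> forall y, I (comb_map g r y).
Proof. by rewrite comb_mapE; apply: comb_bind_ideal. Qed.

Lemma eq_comb_map_supp (X Y : choiceType) (g h : X -> Y) (r : formal_comb R X) :
  (forall x, r x <> 0 :> R -> g x = h x) -> comb_map g r = comb_map h r.
Proof.
move=> gh; apply: formal_comb_eq => y /=; congr infinite_sum.
apply/funext => x; have [->|/eqP/gh -> //] := eqVneq (r x : R) 0.
by case: ifP => _; case: ifP.
Qed.

Lemma comb_mapD (X Y : choiceType) (g : X -> Y) (r s : formal_comb R X) :
  comb_map g (r + s) = comb_map g r + comb_map g s.
Proof. by rewrite !comb_mapE comb_bindD. Qed.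

Lemma comb_mapZ (X Y : choiceType) (g : X -> Y) a (r : formal_comb R X) :
  comb_map g (a *: r) = a *: comb_map g r.
Proof. by rewrite !comb_mapE comb_bindZ. Qed.

Lemma comb_map_unit (X Y : choiceType) (g : X -> Y) x :
  comb_map g (comb_unit x : formal_comb R X) = comb_unit (g x).
Proof. by rewrite comb_mapE comb_bind_unit. Qed.

End MonadComplements.

Definition ideal_filtration (R : topologicalRingType) (I : nat -> set R) :=
  [/\ forall n, open_two_sided_ideal (I n),
      forall m n, (m <= n)%N -> I n `<=` I m &
      forall U, open_subgroup U -> exists n, I n `<=` U].

Section Series.
Context {R : completeLinearRingType}.
Variable I : nat -> set R.
Hypothesis I_filtration : ideal_filtration I.

Lemma filtration_separated (a : R) : (forall n, I n a) -> a = 0.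
Proof.
case: I_filtration => _ _ Ib aI; apply: separated_eq0 => K oK.
by have [n] := Ib _ (open_two_sided_subgroup oK); apply.
Qed.

Lemma filtration_shift n : ideal_filtration (fun m => I (n + m)%N).
Proof.
case: I_filtration => oI dI Ib; split=> [//|m k mk|U /Ib[k kU]].
  by apply: dI; rewrite leq_add2l.
by exists k => x /(dI _ _ (leq_addl _ _)); apply: kU.
Qed.

(** The sum is taken coefficientwise. Modulo [I n] only the first [n] terms count, and each has
    finitely many coefficients outside [I n], so the family of sums converges to zero. The last
    clause keeps track of the support. *)
Lemma comb_series (X : choiceType) (r : nat -> formal_comb R X) :
  (forall m x, I m (r m x)) -> exists s : formal_comb R X,
  (forall n x, I n ((s - \sum_(m < n) r m) x)) /\
  (forall x, (forall m, r m x = 0 :> R) -> s x = 0 :> R).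
Proof.
case: I_filtration => oI dI Ib rI.
have aI n : additive_subgroup (I n) by case: (open_two_sided_subgroup (oI n)).
have r0 x : converges_to_zero (fun m => r m x : R).
  move=> U /Ib[n nU]; apply: sub_finite_set (finite_II n) => m /= Um.
  by rewrite ltnNge; apply/negP => nm; apply/Um/nU/(dI _ _ nm).
have sI n x : I n (infinite_sum (fun m => r m x : R) - \sum_(m < n) (r m x : R)).
  (* The sum over [m < n] becomes one over a finite set, the form required by [infinite_sum_mod]. *)
  rewrite -(big_mkord xpredT (fun m => r m x : R)).
  rewrite (perm_big (enum_fset [fset m in iota 0 n]%fset)); last first.
    rewrite /index_iota subn0; apply: uniq_perm; rewrite ?iota_uniq ?fset_uniq//.
    by move=> m; rewrite [RHS]in_fset.
  apply: infinite_sum_mod => // [|m]; first exact: open_two_sided_subgroup.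
  by rewrite in_fset /= mem_iota add0n /= -leqNgt => /dI; apply.
have s0 : converges_to_zero (fun x => infinite_sum (fun m => r m x : R)).
  apply: finite_supp_converges => U /Ib[n nU].
  have /choice[F FI] : forall m, exists F : {fset X},
      forall x, x \notin F -> I n (r m x).
    move=> m; apply: finite_coset_supp (open_two_sided_subgroup (oI n)).
    exact: coef_converges.
  exists (\bigcup_(m <- iota 0 n) F m)%fset => x xF; apply: nU.
  apply: (subg_sub_l (aI n) (sI n x)); apply: (subg_sum (aI n)) => m _.
  apply: FI; apply: contra xF => xF; apply/bigfcupP; exists (m : nat) => //.
  by rewrite mem_iota ltn_ord.
exists (mk_formal_comb s0); split=> [n x|x rx /=].
  by rewrite comb_coefB comb_coef_sum; apply: sI.
by rewrite (infinite_sum1 (x := 0%N)) // => m _; exact: rx.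
Qed.

End Series.

(** * Contramodule structures on modules that are separated and complete for a family of
    submodules *)

Section ModuleContra.
Context {R : completeLinearRingType} {M : lmodType R} {K : Type}.
Variables (J : K -> set R) (N : K -> set M).
Hypothesis J_ideal : forall i, open_two_sided_ideal (J i).
Hypothesis N_submod : forall i, is_submodule (N i).
Hypothesis JN : forall i a x, J i a -> N i (a *: x).

Lemma act_sum_mod i (s : formal_comb R M) (F G : {fset M}) :
  (forall x, x \notin F -> J i (s x)) -> (F `<=` G)%fset ->
  N i (\sum_(x <- G) (s x : R) *: x - \sum_(x <- F) (s x : R) *: x).
Proof.
move=> FJ /fsubsetP FG; rewrite (big_fsetID _ (mem F) G) /=.
have -> : [fset x in G | x \in F]%fset = F.
  apply/fsetP => x; rewrite !inE /=; apply/andP/idP => [[]//|xF].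
  by split=> //; apply: FG.
rewrite addrC addrK big_seq; apply: (submod_sum (N_submod i)) => x.
by rewrite !inE /= => /andP[_ xF]; apply/JN/FJ.
Qed.

(** The value of the infinite sum [s], tested one modulus at a time: modulo [N i] the terms with
    coefficient in [J i] vanish. Any larger finite set would serve as well as [F], by
    [act_sum_mod]. *)
Definition act_limit (s : formal_comb R M) (y : M) := forall i,
  exists F : {fset M}, (forall x, x \notin F -> J i (s x)) /\
    N i (y - \sum_(x <- F) (s x : R) *: x).

Hypothesis N_separated : forall x, (forall i, N i x) -> x = 0.
Hypothesis act_limit_exists : forall s, exists y, act_limit s y.

Lemma act_limit_mod i s y (G : {fset M}) : act_limit s y ->
  (forall x, x \notin G -> J i (s x)) -> N i (y - \sum_(x <- G) (s x : R) *: x).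
Proof.
move=> /(_ i)[F [FJ yF]] GJ.
apply: (submod_sub_trans (N_submod i) yF).
apply: (submod_sub_trans (N_submod i) (y := \sum_(x <- F `|` G) (s x : R) *: x)%fset).
  by apply: (submod_sub_sym (N_submod i)); apply: act_sum_mod (fsubsetUl _ _).
exact: act_sum_mod (fsubsetUr _ _).
Qed.

Lemma act_limit_unique s y z : act_limit s y -> act_limit s z -> y = z.
Proof.
move=> sy sz; apply/subr0_eq/N_separated => i; have [F [FJ yF]] := sy i.
apply: (submod_sub_trans (N_submod i) yF).
apply: (submod_sub_sym (N_submod i)); exact: act_limit_mod.
Qed.

Lemma act_limitD s t y z :
  act_limit s y -> act_limit t z -> act_limit (s + t) (y + z).
Proof.
move=> sy tz i; have [F [FJ _]] := sy i; have [G [GJ _]] := tz i.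
have {}FJ x : x \notin (F `|` G)%fset -> J i (s x).
  by rewrite inE negb_or => /andP[/FJ].
have {}GJ x : x \notin (F `|` G)%fset -> J i (t x).
  by rewrite inE negb_or => /andP[_ /GJ].
exists (F `|` G)%fset; split=> [x xFG|].
  rewrite Defs.coefD; apply: subgD; [|exact: FJ|exact: GJ].
  exact: (open_two_sided_subgroup (J_ideal i)).2.
under eq_bigr do rewrite Defs.coefD scalerDl.
rewrite big_split /= opprD addrACA; apply: (submodD (N_submod i));
  exact: act_limit_mod.
Qed.

Lemma act_limitZ a s y : act_limit s y -> act_limit (a *: s) (a *: y).
Proof.
move=> sy i; have [F [FJ yF]] := sy i; exists F; split=> [x xF|].
  by rewrite Defs.coefZ; apply: two_sidedMl; [case: (J_ideal i)|apply: FJ].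
under eq_bigr do rewrite Defs.coefZ -scalerA.
by rewrite -scaler_sumr -scalerBr; apply: (submodZ (N_submod i)).
Qed.

Lemma act_limit_unit x : act_limit (comb_unit x) x.
Proof.
move=> i; exists [fset x]%fset; split=> [y|].
  rewrite inE /= => /negPf ->; apply: subg0.
  exact: (open_two_sided_subgroup (J_ideal i)).2.
by rewrite big_seq_fset1 /= eqxx scale1r subrr; apply: (submod0 (N_submod i)).
Qed.

Definition module_act (s : formal_comb R M) : M := sval (cid (act_limit_exists s)).

Lemma module_actP s : act_limit s (module_act s).
Proof. exact: (svalP (cid (act_limit_exists s))). Qed.

(** Separatedness makes the chosen limit canonical, so each law of the action follows by exhibiting
    a limit. *)
Lemma module_actE s y : act_limit s y -> module_act s = y.
Proof. exact/act_limit_unique/module_actP. Qed.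

Lemma module_actD s t : module_act (s + t) = module_act s + module_act t.
Proof. by apply/module_actE/act_limitD; exact: module_actP. Qed.

Lemma module_actZ a s : module_act (a *: s) = a *: module_act s.
Proof. by apply/module_actE/act_limitZ; exact: module_actP. Qed.

Lemma module_act_unit x : module_act (comb_unit x) = x.
Proof. exact/module_actE/act_limit_unit. Qed.

Lemma module_act_ideal i (s : formal_comb R M) :
  (forall x, J i (s x)) -> N i (module_act s).
Proof.
move=> Js; have := @act_limit_mod i s _ fset0 (module_actP s) (fun x _ => Js x).
by rewrite big_seq_fset0 subr0.
Qed.

(* Both sides are additive and R-linear in c and agree on units, and modulo
   N i every c is a finite combination of units. *)
Lemma module_act_join (c : formal_comb R (formal_comb R M)) :
  module_act (comb_map module_act c) = module_act (comb_join c).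
Proof.
pose D d := module_act (comb_map module_act d) - module_act (comb_join d).
have DD d e : D (d + e) = D d + D e.
  by rewrite /D comb_mapD /comb_join comb_bindD !module_actD opprD addrACA.
have DZ a d : D (a *: d) = a *: D d.
  by rewrite /D comb_mapZ /comb_join comb_bindZ !module_actZ scalerBr.
have Du x : D (comb_unit x) = 0.
  by rewrite /D comb_map_unit /comb_join comb_bind_unit module_act_unit subrr.
have D0 : D 0 = 0 by rewrite -(scale0r 0) DZ scale0r.
apply/subr0_eq/N_separated => i; rewrite -/(D c).
have [F FJ] := finite_coset_supp (coef_converges c)
  (open_two_sided_subgroup (J_ideal i)).
have [d [dF [dNF ->]]] := comb_split c F.
have dJ x : J i (d x).
  have [/dF ->|xF] := boolP (x \in F); last by rewrite dNF //; apply: FJ.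
  by apply: subg0; exact: (open_two_sided_subgroup (J_ideal i)).2.
rewrite DD (big_morph D DD D0) big1 => [|x _]; last by rewrite DZ Du scaler0.
rewrite add0r; apply: (submodB (N_submod i)); apply: module_act_ideal.
  exact: comb_map_ideal.
exact: comb_bind_ideal.
Qed.

Definition module_contra : contramodule R :=
  Contramodule module_act_unit module_act_join.

(** Identity maps between two module structures on one carrier: the target rebuilds its operations
    from the action, so their agreement has to be proved. *)
Definition module_contra_to (x : M) : contra_lmod module_contra := x.
Definition module_contra_from (x : contra_lmod module_contra) : M := x.

Lemma module_contra_to_linear : linear module_contra_to.
Proof.
move=> a x y; rewrite -[a *: module_contra_to x]/(module_act (a *: comb_unit x)).
rewrite module_actZ module_act_unit.
transitivity (module_act (comb_unit (a *: x) + comb_unit y)); last by [].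
by rewrite module_actD !module_act_unit.
Qed.

Lemma module_contra_from_linear : linear module_contra_from.
Proof. by move=> a x y; apply/esym/(module_contra_to_linear a x y). Qed.

HB.instance Definition _ := GRing.isLinear.Build R M
  (contra_lmod module_contra) _ module_contra_to module_contra_to_linear.

HB.instance Definition _ := GRing.isLinear.Build R (contra_lmod module_contra)
  M _ module_contra_from module_contra_from_linear.

Lemma module_contra_ideal_mul i x :
  contra_ideal_mul module_contra (J i) x -> N i (module_contra_from x).
Proof. by move=> [s Js <-]; apply: module_act_ideal. Qed.

End ModuleContra.

(** * Consequences of full faithfulness for one ring *)

Lemma contra_linearP (R : completeLinearRingType) (P Q : contramodule R) :
  fully_faithful (contra_forget R) ->
  forall u : {linear contra_lmod P -> contra_lmod Q},
  exists v : contra_hom P Q, v =1 u.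
Proof.
move=> ff u; have [g _ gK] := ff P Q; exists (g u) => x.
have := congr1 (fun w : {linear contra_lmod P -> contra_lmod Q} => w x) (gK u).
by [].
Qed.

(* The quotient of T by N is a discrete contramodule, and by full faithfulness
   the projection onto it is a contramodule morphism. *)
Lemma contra_ideal_mul_submod (R : completeLinearRingType) (T : contramodule R)
    (I : set R) (N : set (contra_lmod T)) :
  fully_faithful (contra_forget R) -> open_two_sided_ideal I ->
  is_submodule N -> (forall a x, I a -> N (a *: x)) ->
  contra_ideal_mul T I `<=` N.
Proof.
move=> ff oI sN IN.
pose N' : {N : set (contra_lmod T) | is_submodule N} := exist _ N sN.
pose Q := Quotient.quot (submod_pred N').
(* The discrete case of the construction: one ideal [I] and one submodule 0, indexed by [unit]. As
   [I] annihilates the quotient, every infinite sum is a finite one. *)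
have s0 (_ : unit) : is_submodule [set (0 : Q)].
  split=> [|x y /= -> ->|a x /= ->] //=; first by rewrite addr0.
  by rewrite scaler0.
have I0 (_ : unit) a (q : Q) : I a -> [set (0 : Q)] (a *: q).
  move=> Ia; rewrite -[q]reprK /=.
  rewrite -[X in a *: X]/(quot_proj N' (repr q)) -linearZ.
  exact/quot_proj_eq0/IN.
have sep (q : Q) : (unit -> [set (0 : Q)] q) -> q = 0 by move=> /(_ tt).
have ex (s : formal_comb R Q) :
    exists y, act_limit (fun _ : unit => I) (fun _ : unit => [set 0]) s y.
  have [F FI] := finite_coset_supp (coef_converges s) (open_two_sided_subgroup oI).
  exists (\sum_(x <- F) (s x : R) *: x) => _; exists F; split=> //=.
  by rewrite subrr.
pose C := module_contra (fun=> oI) s0 I0 sep ex.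
have [v vE] := contra_linearP ff
  (@module_contra_to _ _ _ _ _ (fun=> oI) s0 I0 sep ex \o @quot_proj _ _ N').
move=> _ [r Ir <-]; apply/(@quot_proj_eq0 _ _ N').
have E := contra_fun_act v r; rewrite vE /= in E.
apply: (@module_contra_ideal_mul _ _ _ _ _ (fun=> oI) s0 I0 sep ex tt).
by exists (comb_map v r); [exact: comb_map_ideal | exact/esym/E].
Qed.

(** * Free contramodules and products with ideals *)

Section FreeContramodule.
Context {R : completeLinearRingType}.

Lemma free_act_unit (X : choiceType) (r : formal_comb R X) :
  comb_join (comb_unit r) = r.
Proof. exact: comb_bind_unit. Qed.

Lemma free_act_join (X : choiceType)
    (c : formal_comb R (formal_comb R (formal_comb R X))) :
  comb_join (comb_map (@comb_join R X) c) = comb_join (comb_join c).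
Proof.
rewrite comb_mapE /comb_join !comb_bindA; congr comb_bind.
by apply/funext => r; rewrite comb_bind_unit.
Qed.

Definition free_contra (X : choiceType) : contramodule R :=
  Contramodule (@free_act_unit X) (@free_act_join X).

Lemma free_lmodD (X : choiceType) (r s : formal_comb R X) :
  (r : contra_lmod (free_contra X)) + (s : contra_lmod (free_contra X)) = r + s.
Proof.
by rewrite contra_lmodD /= /comb_join comb_bindD /contra_unit !comb_bind_unit.
Qed.

Lemma free_lmodZ (X : choiceType) a (r : formal_comb R X) :
  a *: (r : contra_lmod (free_contra X)) = a *: r.
Proof.
by rewrite contra_lmodZ /= /comb_join comb_bindZ /contra_unit comb_bind_unit.
Qed.

Program Definition free_map (X Y : choiceType) (g : X -> Y) :
    contra_hom (free_contra X) (free_contra Y) :=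
  @ContraHom R (free_contra X) (free_contra Y) (comb_map g) _.
Next Obligation.
move=> X Y g r; rewrite /= /comb_join !comb_mapE !comb_bindA.
by congr comb_bind; apply/funext => s; rewrite comb_bind_unit comb_mapE.
Qed.

Program Definition free_counit (P : contramodule R) :
    contra_hom (free_contra P) P :=
  @ContraHom R (free_contra P) P contra_act _.
Next Obligation. by move=> P r; rewrite contra_act_join. Qed.

(** The action with its target typed as a module, so that it is a linear map from the
    coefficientwise module and commutes with finite sums. *)
Definition contra_act_linear (P : contramodule R) (r : formal_comb R P) :
  contra_lmod P := contra_act r.

Lemma contra_act_linear_linear (P : contramodule R) :
  linear (@contra_act_linear P).
Proof.
move=> a r s; rewrite /contra_act_linear contra_actD; congr (_ + _).
exact: contra_actZ.
Qed.

HB.instance Definition _ (P : contramodule R) :=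
  GRing.isLinear.Build R (formal_comb R P) (contra_lmod P) _
    (@contra_act_linear P) (@contra_act_linear_linear P).

Lemma contra_ideal_mul_is_submodule (P : contramodule R) (I : set R) :
  open_two_sided_ideal I -> is_submodule (contra_ideal_mul P I).
Proof.
move=> oI; have aI := (open_two_sided_subgroup oI).2; split.
- by exists 0 => // x; rewrite Defs.coef0; apply: subg0.
- move=> _ _ [r Ir <-] [s Is <-]; exists (r + s).
    by move=> x; rewrite Defs.coefD; apply: subgD.
  exact: (raddfD (@contra_act_linear P)).
- move=> a _ [r Ir <-]; exists (a *: r).
    by move=> x; rewrite Defs.coefZ; apply: two_sidedMl => //; case: oI.
  exact: (linearZ_LR (@contra_act_linear P)).
Qed.

Lemma contra_ideal_mul_hom (P Q : contramodule R) (u : contra_hom P Q)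
    (I : set R) x : open_two_sided_ideal I ->
  contra_ideal_mul P I x -> contra_ideal_mul Q I (u x).
Proof.
move=> oI [r Ir <-]; rewrite contra_fun_act.
by exists (comb_map u r) => //; apply: comb_map_ideal.
Qed.

End FreeContramodule.

(** * Strongly right taut maps and successive approximation *)

Lemma right_ideal_generated_image (R S : pzRingType) (f : {rmorphism R -> S})
    (I : set R) s : right_ideal_generated (f @` I) s ->
  exists2 l : seq (R * S), (forall p, p \in l -> I p.1) &
    s = \sum_(p <- l) f p.1 * p.2.
Proof.
pose K := [set s | exists2 l : seq (R * S), (forall p, p \in l -> I p.1) &
  s = \sum_(p <- l) f p.1 * p.2].
move=> /(_ K); apply; split=> [|_ [a Ia <-]]; last first.
  exists [:: (a, 1)] => [p|]; last by rewrite big_seq1 mulr1.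
  by rewrite inE => /eqP ->.
split=> [|_ a [l lI ->]]; last first.
  exists [seq (p.1, p.2 * a) | p <- l] => [_ /mapP[p /lI Ip ->] //|].
  by rewrite big_map mulr_suml; apply: eq_bigr => p _; rewrite mulrA.
split=> [|_ _ [l lI ->] [l' l'I ->]]; first by exists [::]; rewrite ?big_nil.
exists (l ++ [seq (p.1, - p.2) | p <- l']) => [p|].
  by rewrite mem_cat => /orP[/lI //|/mapP[q /l'I Iq ->]].
rewrite big_cat big_map -sumrN; congr (_ + _).
by apply: eq_bigr => p _; rewrite mulrN.
Qed.

Section Taut.
Context {R S : completeLinearRingType} {f : {rmorphism R -> S}}.
Hypothesis fcont : continuous f.
Variable I : nat -> set R.
Hypothesis I_filtration : ideal_filtration I.
Let J n := closure (right_ideal_generated (f @` I n)).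
Hypothesis J_ideal : forall n, open_two_sided_ideal (J n).

Lemma taut_image n a : I n a -> J n (f a).
Proof.
by move=> Ia; apply: subset_closure; apply: sub_gen_smallest; exists a.
Qed.

(** An open ideal [K] of S pulls back to a neighborhood of zero, which contains some [I n]; then [K]
    contains the right ideal generated by the image of [I n], and also its closure, since open
    subgroups are closed. *)
Lemma taut_filtration : ideal_filtration J.
Proof.
case: I_filtration => oI dI Ib; split=> // [m n mn|U oU].
  apply: closure_subset => s sn B [rB mB]; apply: sn; split=> // _ [a Ia <-].
  by apply: mB; exists a => //; apply: dI mn _ Ia.
have [K oK KU] := linear_ideal oU; have oK' := open_two_sided_subgroup oK.
have [n nK] := Ib _ (open_subgroup_preimage fcont oK').
exists n => s Js; apply: KU; apply: (open_subgroup_closed oK').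
apply: closure_subset Js; apply: smallest_sub; first by case: oK => _ [].
by move=> _ [a /nK Ka <-].
Qed.

Lemma taut_approx n m s : J n s -> exists2 l : seq (R * S),
  (forall p, p \in l -> I n p.1) & J m (s - \sum_(p <- l) f p.1 * p.2).
Proof.
move=> /(closure_subgroup (open_two_sided_subgroup (J_ideal m)))[a].
by move=> /right_ideal_generated_image[l lI ->]; exists l.
Qed.

Section Decomposition.
Variable X : choiceType.
Local Notation T := (formal_comb S X).

(** Convertible to the action of the restriction along [f] of [free_contra X]. *)
Let act (r : formal_comb R T) : T := comb_join (comb_pushforward fcont r).

Let actD r s : act (r + s) = act r + act s.
Proof. by rewrite /act comb_pushforwardD /comb_join comb_bindD. Qed.

Let actZ a r : act (a *: r) = f a *: act r.
Proof. by rewrite /act comb_pushforwardZ /comb_join comb_bindZ. Qed.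

Let act_unit z : act (comb_unit z) = z.
Proof. by rewrite /act comb_pushforward_unit /comb_join comb_bind_unit. Qed.

Let act0 : act 0 = 0.
Proof. by rewrite -[0 in LHS](scale0r 0) actZ rmorph0 scale0r. Qed.

Let act_ideal n (r : formal_comb R T) :
  (forall y, I n (r y)) -> forall x, J n (act r x).
Proof. by move=> rI; apply: comb_bind_ideal => // y; apply: taut_image. Qed.

(** Outside a finite set [F] the coefficients of [z] already lie in [J n.+1]. For [x] in [F], the
    coefficient is approximated by a finite sum of products [f a * t] with [a] in [I n], and each
    product contributes [a] times the element [t x]. *)
Lemma taut_step n (z : T) : (forall x, J n (z x)) ->
  exists r : formal_comb R T, [/\ forall y, I n (r y),
    forall y, ~ (exists t x, y = t *: comb_unit x) -> r y = 0 :> R &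
    forall x, J n.+1 ((z - act r) x)].
Proof.
move=> zJ; have aI : additive_subgroup (I n).
  by case: I_filtration => /(_ n)/open_two_sided_subgroup[].
have aJ := (open_two_sided_subgroup (J_ideal n.+1)).2.
have [F FJ] := finite_coset_supp (coef_converges z)
  (open_two_sided_subgroup (J_ideal n.+1)).
have /choice[l lP] : forall x, exists l : seq (R * S),
    (forall p, p \in l -> I n p.1) /\ J n.+1 (z x - \sum_(p <- l) f p.1 * p.2).
  by move=> x; have [l ? ?] := taut_approx n.+1 (zJ x); exists l.
exists (\sum_(x <- F) \sum_(p <- l x) p.1 *: comb_unit (p.2 *: comb_unit x : T)).
split=> [y|y yX|y].
- rewrite comb_coef_sum; apply: (subg_sum aI) => x _; rewrite comb_coef_sum.
  rewrite big_seq; apply: (subg_sum aI) => p /(lP x).1 Ip.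
  rewrite Defs.coefZ /=; case: (y == _); rewrite ?mulr1 ?mulr0 //.
  exact: subg0.
- rewrite comb_coef_sum big1 // => x _; rewrite comb_coef_sum big1 // => p _.
  rewrite Defs.coefZ /=; case: eqP => [yE|_]; last by rewrite mulr0.
  by case: yX; exists p.2, x.
have [d [dF [dNF zE]]] := comb_split z F.
rewrite {1}zE (big_morph act actD act0).
under [X in _ - X]eq_bigr => x _.
  rewrite (big_morph act actD act0).
  under eq_bigr do rewrite actZ act_unit scalerA.
  rewrite -scaler_suml; over.
rewrite addrAC -sumrB Defs.coefD; apply: (subgD aJ).
  rewrite comb_coef_sum; apply: (subg_sum aJ) => x _; rewrite -scalerBl.
  rewrite Defs.coefZ; exact: (two_sidedMr _ (J_ideal n.+1).2 (lP x).2).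
have [/dF ->|yF] := boolP (y \in F); last by rewrite dNF //; apply: FJ.
exact: subg0.
Qed.

(** Iterating [taut_step] from the remainder of the previous stage gives terms with coefficients in
    [I (n + m)], whose series converges. *)
Lemma taut_decomposition n (z : T) : (forall x, J n (z x)) ->
  exists r : formal_comb R (contra_restr fcont (free_contra X)),
    [/\ forall y, I n (r y),
        forall y, r y <> 0 :> R -> exists t x, y = t *: (comb_unit x : T) &
        contra_act r = z].
Proof.
move=> zJ.
(* One function serves all stages and remainders; its default value 0 is never met, since the
   remainders satisfy [wJ]. *)
have /choice[st stP] : forall mz : nat * T, exists r : formal_comb R T,
    (forall x, J mz.1 (mz.2 x)) -> [/\ forall y, I mz.1 (r y),
    forall y, ~ (exists t x, y = t *: comb_unit x) -> r y = 0 :> R &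
    forall x, J mz.1.+1 ((mz.2 - act r) x)].
  move=> [m w] /=; have [wJ|wJ] := pselect (forall x, J m (w x)).
    by have [r rP] := taut_step wJ; exists r.
  by exists 0.
pose fix w m := if m is k.+1 then w k - act (st ((n + k)%N, w k)) else z.
have wJ m x : J (n + m) (w m x).
  elim: m x => [|m IH] x; first by rewrite addn0.
  by rewrite addnS; have [_ _] := stP ((n + m)%N, w m) IH; apply.
pose r m := st ((n + m)%N, w m).
have rP m : [/\ forall y, I (n + m) (r m y),
    forall y, ~ (exists t x, y = t *: comb_unit x) -> r m y = 0 :> R &
    forall x, J (n + m).+1 ((w m - act (r m)) x)].
  exact: stP ((n + m)%N, w m) (wJ m).
have wE m : w m = z - act (\sum_(k < m) r k).
  elim: m => [|m IH]; first by rewrite big_ord0 act0 subr0.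
  by rewrite big_ord_recr /= actD IH opprD addrA -IH.
have [s [sr s0]] := comb_series (filtration_shift I_filtration n)
  (fun m => let: And3 rI _ _ := rP m in rI).
exists s; split=> [y|y sy|].
- by have := sr 0%N y; rewrite big_ord0 subr0 addn0.
(* The terms all vanish off the elements [t x], hence so does their sum. *)
- apply: contrapT => yX; apply: sy; apply: s0 => m.
  by case: (rP m) => _ + _; apply.
suff: act s = z by [].
apply/esym/subr0_eq/formal_comb_eq => x; rewrite Defs.coef0.
apply: (filtration_separated (filtration_shift taut_filtration n)) => m.
have aJ := (open_two_sided_subgroup (J_ideal (n + m))).2.
(* The stage [m] remainder and the action of the tail of the series both lie in [J (n + m)]. *)
have -> : z - act s = w m - act (s - \sum_(k < m) r k).
  have actB (a b : formal_comb R T) : act (a - b) = act a - act b.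
    by rewrite -scaleN1r actD actZ rmorphN1 scaleN1r.
  by rewrite wE actB opprB subrKA.
by rewrite comb_coefB; apply: (subgB aJ) => //; apply: act_ideal.
Qed.

End Decomposition.
End Taut.

(** Each ideal is chosen by tautness inside the previous one and the next member of the countable
    base. *)
Lemma taut_ideal_filtration (R S : completeLinearRingType)
    (f : {rmorphism R -> S}) :
  countable_nbhs0_base R -> strongly_right_taut f ->
  exists I : nat -> set R, [/\ ideal_filtration I, I 0%N = setT &
    forall n, open_two_sided_ideal (closure (right_ideal_generated (f @` I n)))].
Proof.
move=> [B /countable_injP[e e_inj] [Bn Bb]] [tn tb].
have /choice[c cP] : forall N : set R, exists I : set R, nbhs (0 : R) N ->
    [/\ open_two_sided_ideal I, I `<=` N &
        open_two_sided_ideal (closure (right_ideal_generated (f @` I)))].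
  move=> N; have [nN|nN] := pselect (nbhs (0 : R) N); last by exists setT.
  by have [I [oI oJ] IN] := tb N nN; exists I.
(* The base member with code [n]; if there is none, the empty intersection gives the whole ring. *)
pose V n : set R := \bigcap_(A in [set A | B A /\ e A = n]) A.
have nV n : nbhs (0 : R) (V n).
  have [[A [BA An]]|nA] := pselect (exists A, B A /\ e A = n).
    have -> : V n = A.
      apply/seteqP; split=> [x|x Ax A' [BA' A'n]]; first by apply.
      by rewrite (e_inj A' A) ?inE // An.
    exact: Bn.
  have -> : V n = setT; last exact: filterT.
  by apply/seteqP; split=> // x _ A [BA An]; case: nA; exists A.
(* Starting from the whole ring makes the closed ideal at index 0 all of S, so decompositions at
   index 0 cover every formal combination. *)
pose fix I n : set R := if n is m.+1 then c (I m `&` V m) else setT.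
have nI n : nbhs (0 : R) (I n).
  elim: n => [|n IH] /=; first exact: filterT.
  have [[oI tI] _ _] := cP _ (filterI IH (nV n)).
  by apply: open_nbhs_nbhs; split=> //; case: tI => -[[]].
have nIV n : nbhs (0 : R) (I n `&` V n) by apply: filterI; [exact: nI|exact: nV].
have IP n := cP _ (nIV n).
have oI n : open_two_sided_ideal (I n).
  case: n => [|n]; last by case: (IP n).
  by split; [exact: openT|].
exists I; split=> // [|[|n]]; last by case: (IP n).
- split=> // [m n|U [oU aU]].
    move=> /subnK <-; elim: (n - m)%N => // k IH x /=.
    by case: (IP (k + m)%N) => _ Is _ /Is[+ _]; apply: IH.
  have [A BA AU] := Bb U (open_nbhs_nbhs (conj oU (subg0 aU))).
  exists (e A).+1; case: (IP (e A)) => _ Is _ x /Is[_ Vx]; apply: AU.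
  by apply: Vx.
- have -> : closure (right_ideal_generated (f @` I 0%N)) = setT.
    apply/seteqP; split=> // s _; apply: subset_closure => K [rK fK].
    by rewrite -(mul1r s); apply: rK.2; apply: fK; exists 1; rewrite ?rmorph1.
  by split; [exact: openT|].
Qed.

(** Restricting P as a module or as a contramodule gives the same R-module up to the identity map
    [restr_square_inv], to which full faithfulness over R applies. *)
Lemma restr_contra_hom (R S : completeLinearRingType) (f : {rmorphism R -> S})
    (fcont : continuous f) (P : contramodule S) (Q : contramodule R)
    (u : {linear restr_lmod f (contra_lmod P) -> contra_lmod Q}) :
  fully_faithful (contra_forget R) ->
  exists v : contra_hom (contra_restr fcont P) Q, v =1 u.
Proof.
move=> ff.
exact: (contra_linearP ff (u \o @restr_square_inv _ _ f fcont P)).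
Qed.

(** * Full faithfulness and contramodule structures over S *)

Section TautScalars.
Context {R S : completeLinearRingType} {f : {rmorphism R -> S}}.
Hypothesis fcont : continuous f.
Hypothesis R_forget_ff : fully_faithful (contra_forget R).
Variable I : nat -> set R.
Hypothesis I_filtration : ideal_filtration I.
Hypothesis I0 : I 0%N = setT.
Let J n : set S := closure (right_ideal_generated (f @` I n)).
Hypothesis J_ideal : forall n, open_two_sided_ideal (J n).

Let J0 s : J 0%N s.
Proof.
rewrite -(mul1r s); apply: (two_sidedMr s (J_ideal 0%N).2).
by rewrite -(rmorph1 f); apply: taut_image; rewrite I0.
Qed.

(* u o act and act o S[[u]] are R-contramodule morphisms out of S[[P]] which
   agree on the elements t x, and these generate S[[P]] over R. *)
Lemma taut_contra_linear (P Q : contramodule S)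
    (u : {linear contra_lmod P -> contra_lmod Q}) :
  forall r : formal_comb S P,
    u (contra_act r) = contra_act (comb_map (u : P -> Q) r).
Proof.
move=> z.
pose g1 := u \o contra_linear (free_counit P).
pose g2 : contra_hom (free_contra P) Q :=
  contra_comp (free_counit Q) (free_map (u : P -> Q)).
have [v1 v1E] := restr_contra_hom (P := free_contra P)
  (Q := contra_restr fcont Q) fcont
  (@restr_square_hom _ _ f fcont Q \o restr_hom f g1) R_forget_ff.
pose v2 := contra_restr_hom fcont g2.
(* At index 0 every [z] has its coefficients in the ideal, by [J0]. *)
have [r [_ rX <-]] := taut_decomposition fcont I_filtration J_ideal
  (fun x : P => @J0 (z x)).
transitivity (v1 (contra_act r)); first by rewrite v1E.
transitivity (v2 (contra_act r)); last by [].
rewrite !contra_fun_act (_ : comb_map v1 r = comb_map v2 r) //.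
apply: eq_comb_map_supp => y.
move=> /rX[t [x ->]]; rewrite v1E /=.
rewrite /restr_square_hom /restr_hom /= /contra_linear /=.
rewrite comb_mapZ comb_map_unit.
rewrite -[contra_act (t *: comb_unit x)]/(t *: (x : contra_lmod P)).
by rewrite linearZ.
Qed.

Lemma taut_contra_forget_ff : fully_faithful (contra_forget S).
Proof.
move=> P Q.
exists (fun u : {linear contra_lmod P -> contra_lmod Q} =>
  ContraHom (taut_contra_linear u)) => [v|u].
  exact: contra_hom_eq.
exact: linear_hom_eq.
Qed.

Section Module.
Variables (M : lmodType S) (P : contramodule R).
Hypothesis P_separated : Defs.separated P.
Variables (h : {linear restr_lmod f M -> contra_lmod P})
  (g : {linear contra_lmod P -> restr_lmod f M}).
Hypotheses (hK : cancel h g) (gK : cancel g h).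

Let I_ideal n : open_two_sided_ideal (I n). Proof. by case: I_filtration. Qed.

Let IP_submod n : is_submodule (contra_ideal_mul P (I n)).
Proof. exact: contra_ideal_mul_is_submodule. Qed.

(** The topology of P carried over to M; stability under S, and not only under R, is the content of
    [N_submod]. *)
Let N n : set M := [set x | contra_ideal_mul P (I n) (h x)].

(** S is the free contramodule on one point, and [t] to [t x] followed by [h] is a morphism of
    R-contramodules. Decomposing [s] with coefficients in [I n] puts its image in the product of
    [I n] with P. *)
Let JN n s x : J n s -> N n (s *: x).
Proof.
move=> Js; pose F := free_contra (R := S) unit.
pose k (z : contra_lmod F) : M := ((z : formal_comb S unit) tt : S) *: x.
have k_linear : linear k.
  move=> a y z; rewrite /k free_lmodD free_lmodZ Defs.coefD Defs.coefZ.
  by rewrite scalerDl scalerA.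
pose kL : {linear contra_lmod F -> M} :=
  HB.pack k (GRing.isLinear.Build S (contra_lmod F) M _ k k_linear).
have [v vE] := restr_contra_hom (P := F) (Q := P) fcont (h \o restr_hom f kL)
  R_forget_ff.
pose z : formal_comb S unit := s *: comb_unit tt.
have zJ t : J n (z t).
  by rewrite Defs.coefZ; exact: (two_sidedMr _ (J_ideal n).2).
have [r [rI _ rz]] := taut_decomposition fcont I_filtration J_ideal zJ.
have -> : s *: x = k z by rewrite /k Defs.coefZ /= mulr1.
rewrite /N /= -[h (k z)]/((h \o restr_hom f kL) z) -vE.
by apply: contra_ideal_mul_hom => //; exists r.
Qed.

(** The elements of P whose S-multiples all stay in the product form an R-submodule. It contains
    [a y] for [a] in [I n], because [t * f a] lies in the two-sided ideal [J n], hence it contains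
    the whole product by [contra_ideal_mul_submod]. *)
Let N_submod n : is_submodule (N n).
Proof.
have NB : is_submodule [set y | forall t : S,
    contra_ideal_mul P (I n) (h (t *: (g y : M)))].
  split=> [t|x y Nx Ny t|a x Nx t].
  - by rewrite linear0 scaler0 linear0; apply: submod0.
  - by rewrite linearD scalerDr linearD; apply: submodD.
  - by rewrite linearZ /= [_ *: (_ *: _)]scalerA; apply: Nx.
have IPN : contra_ideal_mul P (I n) `<=` _ :=
  contra_ideal_mul_submod R_forget_ff (I_ideal n) NB _.
split=> [|x y Nx Ny|t x Nx].
- by rewrite /N /= linear0; apply: submod0.
- by rewrite /N /= linearD; apply: submodD.
- rewrite /N /= -(hK x); apply: IPN => // a y Ia t'.
  rewrite linearZ /= [_ *: (_ *: _)]scalerA; apply: JN.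
  apply: (two_sidedMl _ (J_ideal n).2).
  exact: taut_image.
Qed.

Let N_separated x : (forall n, N n x) -> x = 0.
Proof.
move=> Nx; apply: (can_inj hK); rewrite linear0.
have : [set (0 : contra_lmod P)] (h x); last by [].
rewrite -P_separated => U oU; case: I_filtration => _ _ Ib.
have [n nU] := Ib U (open_right_subgroup oU).
by have [r Ir rx] := Nx n; exists r => // y; apply/nU/Ir.
Qed.

(** Completeness is borrowed from P: successive differences of partial sums are actions of
    combinations [r n] with coefficients in [I n], and the limit is the action of the series of
    these. *)
Let limit_exists (s : formal_comb S M) : exists y, act_limit J N s y.
Proof.
have /choice[F FJ] : forall n, exists F : {fset M},
    forall x, x \notin F -> J n (s x).
  move=> n; apply: finite_coset_supp (open_two_sided_subgroup (J_ideal n)).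
  exact: coef_converges.
(* The sets increase so that consecutive sums differ by an element of [N n]. The empty start is
   legitimate by [J0], and makes [y 0] zero, so the differences telescope to [y n]. *)
pose fix G n := if n is m.+1 then (G m `|` F m.+1)%fset else fset0.
have GJ n x : x \notin G n -> J n (s x).
  case: n => [|n] //=; rewrite inE negb_or => /andP[_]; exact: FJ.
pose y n := \sum_(x <- G n) (s x : S) *: x.
have yN n : N n (y n.+1 - y n).
  by apply: (act_sum_mod N_submod JN (GJ n)); exact: fsubsetUl.
have /choice[r rP] : forall n, exists r : formal_comb R P,
    (forall x, I n (r x)) /\ contra_act_linear r = h (y n.+1 - y n).
  by move=> n; have [r Ir rE] := yN n; exists r.
have [t [tI _]] := comb_series I_filtration (fun n => (rP n).1).
exists (g (contra_act_linear t)) => n; exists (G n); split; first exact: GJ.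
rewrite -/(y n) /N /= linearB gK.
have -> : h (y n) = contra_act_linear (\sum_(k < n) r k).
  rewrite [RHS]linear_sum /=.
  rewrite (eq_bigr (fun k : 'I_n => h (y k.+1 - y k))) => [|k _]; last first.
    exact: (rP k).2.
  rewrite -[RHS]linear_sum -(big_mkord xpredT (fun k => y k.+1 - y k)).
  by rewrite telescope_sumr // [y 0%N]big_seq_fset0 subr0.
rewrite -linearB; exists (t - \sum_(k < n) r k) => // x; exact: tI.
Qed.

Let Q : contramodule S :=
  module_contra J_ideal N_submod JN N_separated limit_exists.
Let to : {linear M -> contra_lmod Q} :=
  module_contra_to J_ideal N_submod JN N_separated limit_exists.
Let from : {linear contra_lmod Q -> M} :=
  @module_contra_from _ _ _ _ _ J_ideal N_submod JN N_separated limit_exists.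

(** The contramodule has carrier M. It is separated because its products with the open ideals [J n]
    lie in the [N n], which meet in zero. *)
Lemma taut_module_contra : exists Q : contramodule S, Defs.separated Q /\
  exists (a : {linear contra_lmod Q -> M}) (b : {linear M -> contra_lmod Q}),
    cancel a b /\ cancel b a.
Proof.
exists Q; split; last by exists from, to.
apply/seteqP; split=> [x xU|x -> U oU]; last first.
  exists 0 => // y; rewrite Defs.coef0.
  by apply: subg0; exact: (open_right_subgroup oU).2.
suff x0 : from x = 0 by rewrite /set1 /= -[x]/(to (from x)) x0 linear0.
apply: N_separated => n; apply: (module_contra_ideal_mul (x := x)); apply: xU.
by case: (J_ideal n) => oJ [_ rJ].
Qed.

End Module.
End TautScalars.


(** * Fully faithful, essentially surjective functors are equivalences *)

Section Equivalence.
Context {C D : category} (F : functor C D).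
Hypothesis F_ff : fully_faithful F.
Hypothesis F_es : forall d : D, exists c : C, inhabited (iso (F c) d).

Let F_inj a b : injective (@Defs.fmap C D F a b).
Proof. exact: bij_inj (F_ff a b). Qed.

Let lift_ex a b (u : Defs.hom (F a) (F b)) : exists v, Defs.fmap F v = u.
Proof. by have [g _ gK] := F_ff a b; exists (g u). Qed.

Let lift a b (u : Defs.hom (F a) (F b)) := sval (cid (lift_ex u)).

Let liftE a b (u : Defs.hom (F a) (F b)) : Defs.fmap F (lift u) = u.
Proof. exact: (svalP (cid (lift_ex u))). Qed.

(** Object and isomorphism are packed into one existential, so that a single choice yields both as
    data. *)
Let pick_ex d : exists p : {c : C & iso (F c) d}, True.
Proof. by have [c [i]] := F_es d; exists (existT _ c i). Qed.

Let G0 d : C := projT1 (sval (cid (pick_ex d))).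
Let e d : iso (F (G0 d)) d := projT2 (sval (cid (pick_ex d))).

Let Gmap a b (u : Defs.hom a b) : Defs.hom (G0 a) (G0 b) :=
  lift (compm (iso_inv (e b)) (compm u (iso_hom (e a)))).

Let Gmap1 a : Gmap (idm a) = idm (G0 a).
Proof. by apply: F_inj; rewrite liftE comp1m iso_homK fmap1. Qed.

Let GmapM a b c (v : Defs.hom b c) (u : Defs.hom a b) :
  Gmap (compm v u) = compm (Gmap v) (Gmap u).
Proof.
apply: F_inj; rewrite fmapM !liftE -!compmA; congr compm; congr compm.
by rewrite [RHS]compmA iso_invK comp1m.
Qed.

Let G : functor D C := Functor Gmap1 GmapM.

Let GF_iso a : iso (comp_functor G F a) (id_functor C a).
Proof.
exists (lift (iso_hom (e (F a)))) (lift (iso_inv (e (F a)))).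
  by apply: F_inj; rewrite fmapM !liftE iso_homK fmap1.
by apply: F_inj; rewrite fmapM !liftE iso_invK fmap1.
Defined.

Lemma ff_ess_surj_equivalence : is_equivalence F.
Proof.
exists G; split; constructor.
  exists GF_iso => a b u; apply: F_inj; rewrite /= !fmapM !liftE.
  by rewrite compmA iso_invK comp1m.
exists e => a b u; rewrite /= liftE.
by rewrite compmA iso_invK comp1m.
Qed.

End Equivalence.

(** * The comparison functor into the pseudopullback *)

Theorem proposition9p2 (R S : completeLinearRingType) (f : {rmorphism R -> S})
    (f_continuous : continuous f)
    (R_countable : countable_nbhs0_base R)
    (S_countable : countable_nbhs0_base S)
    (f_taut : strongly_right_taut f)
    (R_forget_ff : fully_faithful (contra_forget R)) :
  [/\ is_pseudopullback (restr_functor f) (separ_forget R)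
        (separ_forget S) (separ_restr_functor f_continuous)
        (separ_square f_continuous),
      fully_faithful (separ_forget S),
      fully_faithful (separ_forget R)
    & fully_faithful (contra_forget S)].
Proof.
have [I [I_filtration I0 J_ideal]] := taut_ideal_filtration R_countable f_taut.
have S_forget_ff : fully_faithful (contra_forget S).
  exact: (taut_contra_forget_ff f_continuous R_forget_ff I_filtration).
have separ_ff (A : completeLinearRingType) :
    fully_faithful (contra_forget A) -> fully_faithful (separ_forget A).
  by move=> ff P Q; apply: ff.
split; [|exact: separ_ff..|done].
pose cmp := pseudopullback_comparison (separ_square f_continuous).
apply: (ff_ess_surj_equivalence (F := cmp)) => [P Q|[M P phi]].
  (* A morphism of triples in the image is lifted through its S-linear component. *)
  have [g gK Kg] := separ_ff _ S_forget_ff P Q.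
  exists (fun u : pseudopullback_hom (cmp P) (cmp Q) => g (pph_fst u)) => [v|u].
    exact: gK.
  apply: pseudopullback_hom_eq; first exact: Kg.
  apply: contra_hom_eq => x.
  (* The isomorphisms of the square are identity maps, so compatibility forces both components to
     agree as functions. *)
  have ux : pph_snd u x = pph_fst u x :=
    congr1 (fun w : {linear restr_lmod f (contra_lmod (sval P)) ->
      contra_lmod (contra_restr f_continuous (sval Q))} => w x) (pph_comm u).
  rewrite ux; exact: (congr1 (fun w : {linear contra_lmod (sval P) ->
    contra_lmod (sval Q)} => w x) (Kg (pph_fst u))).
have hK : cancel (iso_hom phi) (iso_inv phi).
  by move=> x; exact: (congr1 (fun w : {linear _ -> _} => w x) (iso_homK phi)).
have gK : cancel (iso_inv phi) (iso_hom phi).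
  by move=> x; exact: (congr1 (fun w : {linear _ -> _} => w x) (iso_invK phi)).
have [Q [sQ [a [b [aK bK]]]]] := taut_module_contra f_continuous R_forget_ff
  I_filtration I0 J_ideal (svalP P) hK gK.
pose h : {linear restr_lmod f M -> contra_lmod (sval P)} := iso_hom phi.
pose g : {linear contra_lmod (sval P) -> restr_lmod f M} := iso_inv phi.
(* Compatibility with [phi] forces the contramodule components to be [h] after [a], and [b] after
   [g]; full faithfulness over R makes these R-linear maps into morphisms of contramodules. *)
have [v vE] := restr_contra_hom f_continuous (h \o restr_hom f a) R_forget_ff.
have [w wE] := contra_linearP R_forget_ff
  (@restr_square_hom _ _ f f_continuous Q \o restr_hom f b \o g).
pose x : pseudopullback (restr_functor f) (separ_forget R) :=
  cmp (exist _ Q sQ).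
pose y : pseudopullback (restr_functor f) (separ_forget R) :=
  PseudopullbackObj phi.
have vc : compm (Defs.fmap (separ_forget R)
      (v : Defs.hom (pp_snd x) (pp_snd y)))
    (iso_hom (pp_iso x)) = compm (iso_hom (pp_iso y))
    (Defs.fmap (restr_functor f) (a : Defs.hom (pp_fst x) (pp_fst y))).
  by apply: linear_hom_eq => z; exact: vE.
have wc : compm (Defs.fmap (separ_forget R)
      (w : Defs.hom (pp_snd y) (pp_snd x)))
    (iso_hom (pp_iso y)) = compm (iso_hom (pp_iso x))
    (Defs.fmap (restr_functor f) (b : Defs.hom (pp_fst y) (pp_fst x))).
  by apply: linear_hom_eq => z; have := wE (h z); rewrite /= hK.
exists (exist _ Q sQ); constructor.
exists (PseudopullbackHom vc) (PseudopullbackHom wc).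
  apply: pseudopullback_hom_eq; first by apply: linear_hom_eq => z; exact: aK.
  by apply: contra_hom_eq => z; rewrite /= wE /= vE /= hK aK.
apply: pseudopullback_hom_eq; first by apply: linear_hom_eq => z; exact: bK.
by apply: contra_hom_eq => z; rewrite /= vE /= wE /= bK gK.
Qed.
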